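(* Let $n\ge 3$ and let $k$ be an integer with $n-1\le k<\frac{n(n-1)}{2}$. Then there exists a left-invariant sub-Riemannian structure of rank $k$ on $SO(n)$ (that is, a $k$-dimensional linear subspace $\mathfrak d\subset\mathfrak{so}(n)$ generating $\mathfrak{so}(n)$ by commutation, together with a scalar product $(\cdot,\cdot)_{\mathfrak d}$ on $\mathfrak d$) whose normal sub-Riemannian geodesic flow on $T^*SO(n)$ is completely integrable in the non-commutative sense.
   Context: A left-invariant sub-Riemannian structure on $SO(n)$ consists of the left-invariant distribution $\mathcal D|_g=dL_g(\mathfrak d)$ with the left-invariant metric determined by $(\cdot,\cdot)_{\mathfrak d}$. Its normal geodesic flow is the Hamiltonian flow on $T^*SO(n)$ of the left-invariant Hamiltonian $H_{sR}$ whose value on a covector $x\in\mathfrak{so}(n)^*$ is $\tfrac12\|x|_{\mathfrak d}\|^2$ (dual norm). A Hamiltonian system on a symplectic manifold $M$ is completely integrable in the non-commutative sense (Mishchenko–Fomenko, Nekhoroshev) if it has a set $\mathcal F$ of first integrals, closed under the Poisson bracket, such that at generic points $\dim F+\dim\ker(\{\cdot,\cdot\}|_F)=\dim M$, where $F$ is the span of the differentials of elements of $\mathcal F$ at the point. *)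

(* Defs.v *)
From HB Require Import structures.
From mathcomp Require Import all_boot all_order all_algebra.
From mathcomp Require Import all_classical all_reals all_analysis.
From mathcomp Require Import ring.

Set Implicit Arguments.
Unset Strict Implicit.
Unset Printing Implicit Defensive.

Import Order.TTheory GRing.Theory Num.Theory.
Import numFieldNormedType.Exports.

Local Open Scope classical_set_scope.
Local Open Scope ring_scope.

(* T^*SO(n) is left-trivialized as SO(n) x so(n)^*, and so(n)^* is given the
   coordinates dual to the basis E_ij - E_ji (i < j) of so(n): a covector is
   written as the skew matrix x acting on so(n) by A |-> [pairing x A].
   Tangent vectors at (g, x) are pairs (A, xi), standing for the velocity
   (g A, xi), with A in so(n) and xi in so(n)^*; cotangent vectors are pairs
   (alpha, a) in so(n)^* x so(n), acting by <alpha, A> + <xi, a>. *)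

Section LieAlgebra.
Variables (R : realType) (n : nat).
Implicit Types (A B x : 'M[R]_n) (V : {vspace 'M[R]_n}).

Definition so_mx : set 'M[R]_n := [set A | A^T = - A].

Definition SO_mx : set 'M[R]_n := [set g | g *m g^T = 1%:M /\ \det g = 1].

Definition lie A B : 'M[R]_n := A *m B - B *m A.

(* For skew matrices this is \sum_(i < j) x i j * A i j. *)
Definition pairing x A : R := \tr (x^T *m A) / 2%:R.

Definition lie_closed V : Prop :=
  forall A B, A \in V -> B \in V -> lie A B \in V.

Definition lie_generates_so V : Prop :=
  forall W : {vspace 'M[R]_n}, (V <= W)%VS -> lie_closed W ->
  forall A, so_mx A -> A \in W.

(* [b] is a scalar product on V; its values off V are irrelevant. *)
Definition scalar_product_on V (b : 'M[R]_n -> 'M[R]_n -> R) : Prop :=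
  [/\ forall u v, u \in V -> v \in V -> b u v = b v u,
      forall (c : R) u v w, u \in V -> v \in V -> w \in V ->
        b (c *: u + v) w = c * b u w + b v w
    & forall u, u \in V -> u != 0 -> 0 < b u u].

(* Left-invariant sub-Riemannian structure on SO(n): the distribution at g is
   { g A | A in sr_space }, with the left-translated metric. *)
Record sub_riemannian := SubRiemannian {
  sr_space : {vspace 'M[R]_n};
  sr_metric : 'M[R]_n -> 'M[R]_n -> R;
  sr_space_so : forall A, A \in sr_space -> so_mx A;
  sr_generates : lie_generates_so sr_space;
  sr_metricP : scalar_product_on sr_space sr_metric
}.

Definition sr_rank (S : sub_riemannian) : nat := \dim (sr_space S).

(* Dual norm of the restriction of the covector x to the distribution. *)
Definition sr_dual_norm (S : sub_riemannian) x : R :=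
  sup [set `|pairing x v| | v in
        [set v | v \in sr_space S /\ sr_metric S v v <= 1]].

End LieAlgebra.

Section Smooth.
Variables (R : realType) (V : normedModType R).

Fixpoint cont_diff (k : nat) (f : V -> R) : Prop :=
  match k with
  | 0 => continuous f
  | k'.+1 => (forall p, differentiable f p) /\
             forall v, cont_diff k' (fun p => 'D_v f p)
  end.

Definition smooth (f : V -> R) : Prop := forall k, cont_diff k f.

End Smooth.

Section CotangentBundle.
Variables (R : realType) (n : nat).

Notation amb := ('M[R]_n * 'M[R]_n)%type.

Definition cotangent_SO : set amb :=
  [set p | SO_mx p.1 /\ so_mx p.2].

(* SO(n) x so(n)^* is a closed submanifold of the space [amb] of pairs of
   matrices, so the smooth functions on it are the restrictions of smooth
   functions [amb -> R].  An observable is represented by such an extension;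
   smoothness apart, nothing below depends on its values off [cotangent_SO],
   as only derivatives in directions tangent to [cotangent_SO] are used. *)

Definition so_basis (i j : 'I_n) : 'M[R]_n := delta_mx i j - delta_mx j i.

Definition differential (f : amb -> R) (p : amb) : amb :=
  (\matrix_(i, j) 'D_((p.1 *m so_basis i j, 0) : amb) f p,
   \matrix_(i, j) 'D_((0, so_basis i j) : amb) f p).

(* The canonical symplectic form - d(theta), theta the Liouville form, at a
   point (g, x), in the left trivialization. *)
Definition canonical_form (p v w : amb) : R :=
  pairing w.2 v.1 - pairing v.2 w.1 + pairing p.2 (lie v.1 w.1).

(* The tangent vector dual to the cotangent vector u under the symplectic
   form; see [canonical_form_sharp]. *)
Definition sharp (p u : amb) : amb := (u.2, lie p.2 u.2 - u.1).

Lemma canonical_form_sharp (p u v : amb) : so_mx u.2 ->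
  canonical_form p (sharp p u) v = pairing u.1 v.1 + pairing v.2 u.2.
Proof.
case: p u v => g x [al a] [B et] /= sa.
have E : pairing x (lie a B) = pairing (lie x a) B.
  rewrite /pairing /lie !linearB /= !trmx_mul sa mulmxBl !linearB /=.
  congr (_ / _); rewrite !mulmxN !mulNmx !linearN /= opprK addrC.
  by rewrite !mulmxA [\tr (x^T *m B *m a)]mxtrace_mulC !mulmxA.
rewrite /canonical_form /sharp /= E /pairing [(_ - al)^T]linearB /= mulmxBl linearB /=.
by ring.
Qed.

Definition hamiltonian_field (H : amb -> R) (p : amb) : amb :=
  sharp p (differential H p).

Definition poisson_tensor (p u v : amb) : R :=
  canonical_form p (sharp p u) (sharp p v).

Definition poisson (f h : amb -> R) (p : amb) : R :=
  canonical_form p (hamiltonian_field f p) (hamiltonian_field h p).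

Definition first_integral (H f : amb -> R) : Prop :=
  forall p, cotangent_SO p -> poisson f H p = 0.

Definition poisson_closed (F : set (amb -> R)) : Prop :=
  forall f h, F f -> F h ->
  exists2 k, F k & forall p, cotangent_SO p -> k p = poisson f h p.

(* [U] is the linear span of [X]. *)
Definition is_span (X : set amb) (U : {vspace amb}) : Prop :=
  (forall u, X u -> u \in U) /\
  forall W : {vspace amb}, (forall u, X u -> u \in W) -> (U <= W)%VS.

(* [K] is the kernel of the restriction to [U] of the Poisson tensor at p. *)
Definition is_poisson_kernel (p : amb) (U K : {vspace amb}) : Prop :=
  forall u, u \in K <->
    u \in U /\ forall v, v \in U -> poisson_tensor p u v = 0.

Definition complete_at (F : set (amb -> R)) (p : amb) : Prop :=
  exists U K : {vspace amb},
    [/\ is_span [set differential f p | f in F] U,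
        is_poisson_kernel p U K
      & (\dim U + \dim K = n * n.-1)%N]. (* dim T^*SO(n) = n (n - 1) *)

(* Non-commutative complete integrability of the Hamiltonian flow of H on
   T^*SO(n); "generic" means on an open dense subset. *)
Definition nc_integrable (H : amb -> R) : Prop :=
  exists F : set (amb -> R),
    [/\ forall f, F f -> smooth f,
        forall f, F f -> first_integral H f,
        poisson_closed F
      & exists O : set amb,
          [/\ open O, cotangent_SO `<=` closure (O `&` cotangent_SO)
            & forall p, O p -> cotangent_SO p -> complete_at F p]].

(* The Hamiltonian whose flow is the normal sub-Riemannian geodesic flow. *)
Definition sr_hamiltonian (S : sub_riemannian R n) (p : amb) : R :=
  (sr_dual_norm S p.2) ^+ 2 / 2%:R.

End CotangentBundle.

(* Main.v *)
From HB Require Import structures.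
Require Import Defs.
From mathcomp Require Import all_boot all_order all_algebra.
From mathcomp Require Import all_classical all_reals all_analysis.
From mathcomp Require Import ring lra zify.

Set Implicit Arguments.
Unset Strict Implicit.
Unset Printing Implicit Defensive.

Import Order.TTheory GRing.Theory Num.Theory.
Import numFieldNormedType.Exports.

Local Open Scope classical_set_scope.
Local Open Scope ring_scope.

(** Take the sub-Riemannian metrics whose Hamiltonian is a sum of differences
    of quadratic Casimirs of consecutive members of the chain
    so(1) < so(2) < ... < so(n), where so(r) consists of the skew matrices
    supported in the upper left r x r corner: d is spanned by the E_ij, i < j,
    with j in a set T of columns that contains the last one, so that d
    generates so(n); every rank k in the given range is the sum of the numbers
    of such i over a suitable T.  These Hamiltonians have as integrals the left
    momentum map and the traces of the powers of the corners x_r of x.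

    The span U of the differentials is coisotropic where, for every r, the first
    r entries of the column of x next to the corner x_r form a cyclic vector of
    x_r.  Indeed a covector orthogonal to the differentials of the momentum map
    is (0, a); let a be in so(r + 1), orthogonal to all odd powers of corners
    for the Lie-Poisson form at x, and let v, u be the last columns of x_(r+1)
    and a.  Then u is orthogonal to all odd x_r^i v, hence a combination of the
    even x_r^i v, hence the last column of a combination c of odd powers of
    x_(r+1).  As a - c lies in so(r), induction on r puts (0, a) in U.  For
    coisotropic U the kernel is the symplectic orthogonal of U, and the
    dimensions add up to that of the cotangent bundle. *)

(** * The trace form on so(n) *)

Section Pairing.
Variables (R : realType) (n : nat).
Implicit Types (x y A B : 'M[R]_n).

Lemma pairingPl c x y A : pairing (c *: x + y) A = c * pairing x A + pairing y A.
Proof. by rewrite /pairing linearP /= mulmxDl -scalemxAl linearP /=; ring. Qed.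

Lemma pairingPr c x A B : pairing x (c *: A + B) = c * pairing x A + pairing x B.
Proof. by rewrite /pairing mulmxDr -scalemxAr linearP /=; ring. Qed.

Lemma pairing0l A : pairing 0 A = 0.
Proof. by rewrite /pairing linear0 mul0mx linear0 mul0r. Qed.

Lemma pairing0r A : pairing A 0 = 0.
Proof. by rewrite /pairing mulmx0 linear0 mul0r. Qed.

Lemma pairingDl x y A : pairing (x + y) A = pairing x A + pairing y A.
Proof. by have := pairingPl 1 x y A; rewrite scale1r mul1r. Qed.

Lemma pairingDr x A B : pairing x (A + B) = pairing x A + pairing x B.
Proof. by have := pairingPr 1 x A B; rewrite scale1r mul1r. Qed.

Lemma pairingZl c x A : pairing (c *: x) A = c * pairing x A.
Proof. by have := pairingPl c x 0 A; rewrite pairing0l !addr0. Qed.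

Lemma pairingZr c x A : pairing x (c *: A) = c * pairing x A.
Proof. by have := pairingPr c x A 0; rewrite pairing0r !addr0. Qed.

Lemma pairingNl x A : pairing (- x) A = - pairing x A.
Proof. by rewrite -scaleN1r pairingZl mulN1r. Qed.

Lemma pairingNr x A : pairing x (- A) = - pairing x A.
Proof. by rewrite -scaleN1r pairingZr mulN1r. Qed.

Lemma pairing_suml (I : Type) (r : seq I) (P : pred I) (F : I -> 'M[R]_n) A :
  pairing (\sum_(i <- r | P i) F i) A = \sum_(i <- r | P i) pairing (F i) A.
Proof.
apply: (big_morph (fun x => pairing x A)); last exact: pairing0l.
by move=> x y; exact: pairingDl.
Qed.

Lemma pairing_sumr (I : Type) (r : seq I) (P : pred I) (F : I -> 'M[R]_n) x :
  pairing x (\sum_(i <- r | P i) F i) = \sum_(i <- r | P i) pairing x (F i).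
Proof.
apply: (big_morph (fun A => pairing x A)); last exact: pairing0r.
by move=> A B; exact: pairingDr.
Qed.

Lemma pairingC x y : pairing x y = pairing y x.
Proof. by rewrite /pairing -mxtrace_tr trmx_mul trmxK. Qed.

Lemma pairing_sqr x : pairing x x = (\sum_i \sum_j x i j ^+ 2) / 2%:R.
Proof.
rewrite /pairing; congr (_ / _); rewrite /mxtrace exchange_big /=.
apply: eq_bigr => i _; rewrite mxE; apply: eq_bigr => j _.
by rewrite mxE expr2.
Qed.

Lemma pairing_ge0 x : 0 <= pairing x x.
Proof.
rewrite pairing_sqr divr_ge0 // sumr_ge0 // => i _; rewrite sumr_ge0 // => j _.
exact: sqr_ge0.
Qed.

Lemma pairing_eq0 x : pairing x x = 0 -> x = 0.
Proof.
rewrite pairing_sqr => /eqP; rewrite mulf_eq0 invr_eq0 pnatr_eq0 orbF => /eqP E.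
apply/matrixP => i j; rewrite mxE; apply/eqP; rewrite -sqrf_eq0; apply/eqP.
have S0 k l : 0 <= x k l ^+ 2 by exact: sqr_ge0.
have /psumr_eq0P -/(_ E i isT) Ei : forall k, true -> 0 <= \sum_l x k l ^+ 2.
  by move=> k _; apply: sumr_ge0.
by have /psumr_eq0P -/(_ Ei j isT) : forall l, true -> 0 <= x i l ^+ 2.
Qed.

Lemma pairing_skew x A : so_mx x -> pairing x A = - \tr (x *m A) / 2%:R.
Proof. by move=> sx; rewrite /pairing sx mulNmx linearN. Qed.

(** Ad-invariance of the trace form, by cyclicity of the trace: the Lie-Poisson bracket at [x] of
    two linear functions [a], [b] takes the form [pairing (lie x a) b]. *)
Lemma pairing_ad x A B : so_mx A -> pairing (lie x A) B = pairing x (lie A B).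
Proof.
move=> sA; rewrite /pairing; have -> : (lie x A)^T = x^T *m A - A *m x^T.
  by rewrite /lie linearB /= !trmx_mul sA mulNmx mulmxN opprK addrC.
congr (_ / _); rewrite /lie mulmxBl mulmxBr !raddfB /= !mulmxA.
by rewrite -[A *m _ *m _]mulmxA [\tr (A *m _)]mxtrace_mulC.
Qed.

Lemma lieC A B : lie A B = - lie B A.
Proof. by rewrite /lie opprB. Qed.

Lemma lieDr x A B : lie x (A + B) = lie x A + lie x B.
Proof. by rewrite /lie mulmxDr mulmxDl opprD addrACA. Qed.

Lemma lieZr c x A : lie x (c *: A) = c *: lie x A.
Proof. by rewrite /lie -scalemxAr -scalemxAl scalerBr. Qed.

Lemma lieNr x A : lie x (- A) = - lie x A.
Proof. by rewrite -scaleN1r lieZr scaleN1r. Qed.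

Lemma lie0r x : lie x 0 = 0.
Proof. by rewrite /lie mulmx0 mul0mx subr0. Qed.

Lemma lie_so A B : so_mx A -> so_mx B -> so_mx (lie A B).
Proof.
move=> sA sB; rewrite /so_mx /= /lie linearB /= !trmx_mul sA sB.
by rewrite !mulNmx !mulmxN !opprK opprB.
Qed.

Lemma so_mxP c A B : so_mx A -> so_mx B -> so_mx (c *: A + B).
Proof. by move=> sA sB; rewrite /so_mx /= linearP /= sA sB scalerN opprD. Qed.

Lemma so_mx0 : so_mx (0 : 'M[R]_n).
Proof. by rewrite /so_mx /= linear0 oppr0. Qed.

Lemma so_mxB A B : so_mx A -> so_mx B -> so_mx (A - B).
Proof. by move=> sA sB; rewrite addrC -scaleN1r; apply: so_mxP. Qed.

Lemma so_mxE A i j : so_mx A -> A j i = - A i j.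
Proof. by move=> sA; have /matrixP/(_ i j) := sA; rewrite !mxE. Qed.

Lemma so_basis_so (i j : 'I_n) : so_mx (so_basis R i j).
Proof. by rewrite /so_mx /= /so_basis linearB /= !trmx_delta opprB. Qed.

Lemma pairing_basis (i j : 'I_n) A : so_mx A -> pairing (so_basis R i j) A = A i j.
Proof.
move=> sA; rewrite /pairing /so_basis linearB /= !trmx_delta mulmxBl linearB /=.
have T k l : \tr (delta_mx k l *m A) = A l k.
  rewrite /mxtrace (bigD1 k) //= big1 ?addr0 => [|m /negPf mk].
    rewrite mxE (bigD1 l) //= big1 ?addr0 => [|m /negPf ml];
      rewrite !mxE !eqxx /= ?mul1r //.
    by rewrite ml mul0r.
  by rewrite mxE big1 // => p _; rewrite mxE mk mul0r.
rewrite !T (so_mxE i j sA); lra.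
Qed.

(** Serves to read off [differential]: if the derivatives along the [so_basis i j] are their
    pairings with a skew matrix, that matrix is the component sought. *)
Lemma skew_matrixE A : so_mx A -> \matrix_(i, j) pairing (so_basis R i j) A = A.
Proof. by move=> sA; apply/matrixP => i j; rewrite mxE pairing_basis. Qed.

End Pairing.

(** * Corners of skew matrices and their odd powers *)

Section Truncation.
Variables (R : realType) (n : nat).
Implicit Types (x A B M : 'M[R]_n).

(* Locked, as [mulmxA] would otherwise see through the definition. *)
Fact corner_key : unit. Proof. by []. Qed.

Definition corner r x : 'M[R]_n :=
  locked_with corner_key (pid_mx r *m x *m pid_mx r).

Lemma cornerE r x : corner r x = pid_mx r *m x *m pid_mx r.
Proof. exact: locked_withE. Qed.

Lemma pid_mx_mul r s : (r <= s)%N ->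
  (pid_mx r : 'M[R]_n) *m (pid_mx s : 'M[R]_n) = pid_mx r.
Proof. by move=> rs; rewrite mul_pid_mx (minn_idPl rs) pid_mx_minh. Qed.

Lemma pid_mx_mulr r s : (r <= s)%N ->
  (pid_mx s : 'M[R]_n) *m (pid_mx r : 'M[R]_n) = pid_mx r.
Proof. by move=> rs; rewrite mul_pid_mx (minn_idPr rs) pid_mx_minh. Qed.

Lemma corner_so r x : so_mx x -> so_mx (corner r x).
Proof.
move=> sx; rewrite /so_mx /= !cornerE !trmx_mul !tr_pid_mx sx.
by rewrite mulNmx mulmxN mulmxA.
Qed.

Lemma corner_fix r M : corner r M = M ->
  pid_mx r *m M = M /\ M *m pid_mx r = M.
Proof.
move=> <-; rewrite !cornerE !mulmxA pid_mx_mul //.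
by rewrite -[X in _ /\ X = _]mulmxA pid_mx_mul.
Qed.

(** The exponent is positive because the power 0 is the identity of full size, in general not
    supported in the corner. *)
Lemma cornerX r x m : corner r (corner r x ^+ m.+1) = corner r x ^+ m.+1.
Proof.
rewrite {1}cornerE; have -> : pid_mx r *m corner r x ^+ m.+1 = corner r x ^+ m.+1.
  by rewrite exprS -mulmxE mulmxA !cornerE !mulmxA pid_mx_mul.
rewrite exprSr -[in LHS]mulmxE -mulmxA.
by have -> : corner r x *m pid_mx r = corner r x by rewrite !cornerE -mulmxA pid_mx_mul.
Qed.

Lemma so_mxX A m : so_mx A -> so_mx (A ^+ m.*2.+1).
Proof.
move=> sA; rewrite /so_mx /=.
have -> : (A ^+ m.*2.+1)^T = A^T ^+ m.*2.+1.
  elim: (m.*2.+1) => [|p IH]; first by rewrite !expr0 trmx1.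
  by rewrite exprS -mulmxE trmx_mul IH mulmxE -exprSr.
by rewrite sA exprNn -signr_odd /= odd_double mulN1r.
Qed.

Lemma commX A m : A *m A ^+ m = A ^+ m *m A.
Proof. by rewrite !mulmxE -exprS exprSr. Qed.

(** The projections absorbed by [B] and [C] move, by cyclicity of the trace, onto the two sides of
    [A]. *)
Lemma mxtrace_corner r A B C : corner r B = B -> corner r C = C ->
  \tr (A *m B *m C) = \tr (corner r A *m B *m C).
Proof.
move=> hB hC; have [BL BR] := corner_fix hB; have [CL CR] := corner_fix hC.
by rewrite -{1}CR -{1}BL !mulmxA mxtrace_mulC !cornerE !mulmxA.
Qed.

(* The odd powers of the corners are, up to a factor, the gradients of the
   Gelfand-Tsetlin functions, which are thus in involution. *)
Lemma corner_powers_commute x i j s t : so_mx x ->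
  pairing (lie x (corner s x ^+ i.*2.+1)) (corner t x ^+ j.*2.+1) = 0.
Proof.
move=> sx; set A := corner s x ^+ _; set B := corner t x ^+ _.
have sA : so_mx A by exact/so_mxX/corner_so.
have cA : corner s x *m A = A *m corner s x := commX _ _.
have cB : corner t x *m B = B *m corner t x := commX _ _.
rewrite pairing_ad // pairing_skew // /lie mulmxBr linearB /=.
suff -> : \tr (x *m (A *m B)) = \tr (x *m (B *m A)) by rewrite subrr oppr0 mul0r.
(* Both powers live in the larger of the two corners, so in the traces [x] may be replaced by that
   corner, which commutes with its own powers. *)
have [st|/ltnW ts] := leqP s t.
- have hB : corner t B = B by exact: cornerX.
  have hA : corner t A = A.
    by rewrite -[A]cornerX !cornerE !mulmxA pid_mx_mulr // -!mulmxA pid_mx_mul.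
  rewrite !mulmxA (mxtrace_corner _ hA hB) (mxtrace_corner _ hB hA).
  by rewrite [in RHS]cB -[in RHS]mulmxA [RHS]mxtrace_mulC.
- have hA : corner s A = A by exact: cornerX.
  have hB : corner s B = B.
    by rewrite -[B]cornerX !cornerE !mulmxA pid_mx_mulr // -!mulmxA pid_mx_mul.
  rewrite !mulmxA (mxtrace_corner _ hA hB) (mxtrace_corner _ hB hA).
  by rewrite [in LHS]cA -[in LHS]mulmxA [LHS]mxtrace_mulC.
Qed.

End Truncation.

(** * Cyclic vectors and coisotropy of the odd powers *)

Section Krylov.
Variables (R : realType) (n : nat).
Implicit Types (x A B M : 'M[R]_n) (u v y z : 'cV[R]_n) (r : 'I_n).

Fact last_col_key : unit. Proof. by []. Qed.

(** Indices start at 0, so column [r] is the one adjoined in passing from the corner of size [r] to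
    that of size [r.+1]. *)
Definition last_col r x : 'cV[R]_n :=
  locked_with last_col_key (pid_mx r *m col r x).

Lemma last_colE r x : last_col r x = pid_mx r *m col r x.
Proof. exact: locked_withE. Qed.

(* The columns [j < r] form, in reverse order, the Krylov basis of the corner of
   size r started at the r-th column; this order makes the matrix triangular
   when x is tridiagonal. *)
Definition krylov r x : 'M[R]_n := \matrix_(i, j)
  if (j < r)%N then (corner r x ^+ (r.-1 - j) *m last_col r x) i 0
  else (i == j)%:R.

Lemma pid_last_col r x : pid_mx r *m last_col r x = last_col r x.
Proof. by rewrite last_colE mulmxA pid_mx_mul. Qed.

Lemma pid_corner r x : pid_mx r *m corner r x = corner r x.
Proof. by rewrite !cornerE !mulmxA pid_mx_mul. Qed.

Lemma pid_cornerX r x m y : pid_mx r *m y = y ->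
  pid_mx r *m (corner r x ^+ m *m y) = corner r x ^+ m *m y.
Proof.
case: m => [|m] py; first by rewrite expr0 mul1mx.
by rewrite exprS -mulmxE -!mulmxA mulmxA pid_corner.
Qed.

(** Expand [u] in the columns of the invertible [krylov r x] and project: [pid_mx r] kills the unit
    columns from [r] on, and turns the others into the Krylov vectors. *)
Lemma krylov_span r x u : \det (krylov r x) != 0 -> pid_mx r *m u = u ->
  exists w : 'I_n -> R, u = \sum_(j < n | (j < r)%N)
    w j *: (corner r x ^+ (r.-1 - j) *m last_col r x).
Proof.
move=> dK pu; pose w := invmx (krylov r x) *m u.
have uE : u = krylov r x *m w.
  by rewrite /w mulmxA mulmxV ?mul1mx // unitmxE unitfE.
have {}uE : u = \sum_j w j 0 *: col j (krylov r x).
  rewrite uE; apply/colP => i; rewrite mxE summxE.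
  by apply: eq_bigr => j _; rewrite !mxE mulrC.
exists (fun j => w j 0); rewrite -pu {1}uE mulmx_sumr.
rewrite (bigID (fun j : 'I_n => (j < r)%N)) /= [X in _ + X]big1 ?addr0; last first.
  move=> j jr; rewrite -scalemxAr; apply/eqP; rewrite scaler_eq0; apply/orP; right.
  apply/eqP/matrixP => i k; rewrite !mxE big1 // => l _; rewrite !mxE (negPf jr).
  have [->|] := eqVneq l j; last by rewrite mulr0.
  by rewrite val_eqE; have [->|_] := eqVneq i j; rewrite ?(negPf jr) ?andbF mul0r.
apply: eq_bigr => j jr; rewrite -scalemxAr; congr (_ *: _).
rewrite -[RHS]pid_cornerX ?pid_last_col //; congr (_ *m _).
by apply/colP => i; rewrite !mxE jr.
Qed.

Lemma quad_skew A y : so_mx A -> y^T *m A *m y = 0.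
Proof.
move=> sA; have /(congr1 (fun M : 'M[R]_1 => M 0 0)) :
    (y^T *m A *m y)^T = - (y^T *m A *m y).
  by rewrite !trmx_mul trmxK sA mulNmx mulmxN mulmxA.
by rewrite mxE [RHS]mxE => E; apply/matrixP => i j; rewrite !ord1 [RHS]mxE; lra.
Qed.

Lemma trmxX A m : so_mx A -> (A ^+ m)^T = (-1) ^+ m *: A ^+ m.
Proof.
move=> sA; elim: m => [|m IH]; first by rewrite !expr0 trmx1 scale1r.
rewrite exprS -mulmxE trmx_mul IH sA mulmxN -scalemxAl -scaleN1r scalerA -exprS.
by rewrite mulmxE -exprSr -exprS.
Qed.

(** Transposing [A ^+ i] leaves, up to sign, the quadratic form at [v] of an odd power of [A], which
    is skew. *)
Lemma odd_orthogonal A v i j : so_mx A -> odd (i + j) ->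
  (A ^+ i *m v)^T *m (A ^+ j *m v) = 0.
Proof.
move=> sA oij; rewrite trmx_mul trmxX // -scalemxAr -scalemxAl.
rewrite mulmxA -[_ *m A ^+ i *m _]mulmxA mulmxE -exprD -(odd_double_half (i + j)) oij.
by rewrite quad_skew ?scaler0 //; exact: so_mxX.
Qed.

Lemma sqr_cV_eq0 y : y^T *m y = 0 -> y = 0.
Proof.
move=> /(congr1 (fun M : 'M[R]_1 => M 0 0)); rewrite mxE [RHS]mxE => /eqP.
rewrite psumr_eq0 => [|i _]; last by rewrite mxE -expr2 sqr_ge0.
move=> /allP E; apply/colP => i; have := E i (mem_index_enum _).
by rewrite !mxE -expr2 sqrf_eq0 => /eqP.
Qed.

(** The odd part [o] of [u] is orthogonal to the even part by [odd_orthogonal] and to [u] by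
    hypothesis, hence to itself; over the reals it vanishes. *)
Lemma even_krylov_span A v u (I : finType) (P : pred I) (e : I -> nat) (w : I -> R) :
  so_mx A -> u = \sum_(i | P i) w i *: (A ^+ e i *m v) ->
  (forall m, v^T *m A ^+ m.*2.+1 *m u = 0) ->
  u = \sum_(i | P i && ~~ odd (e i)) w i *: (A ^+ e i *m v).
Proof.
move=> sA uE uo; rewrite [LHS]uE (bigID (fun i => odd (e i))) /=.
set o := \sum_(i | _ && odd _) _; set ev := \sum_(i | _ && ~~ _) _.
suff -> : o = 0 by rewrite add0r.
apply: sqr_cV_eq0.
have -> : o^T *m o = o^T *m u - o^T *m ev.
  by rewrite -mulmxBr uE (bigID (fun i => odd (e i))) /= addrK.
have oE (y : 'cV[R]_n) : (forall i, odd (e i) -> (A ^+ e i *m v)^T *m y = 0) ->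
    o^T *m y = 0.
  move=> h; rewrite /o linear_sum mulmx_suml big1 // => i /andP[_ /h E].
  by rewrite linearZ /= -scalemxAl E scaler0.
rewrite !oE ?subr0 // => i oi.
  rewrite /ev mulmx_sumr big1 // => j /andP[_ ej].
  by rewrite -scalemxAr odd_orthogonal ?scaler0 // oddD oi (negPf ej).
rewrite trmx_mul trmxX // -scalemxAr -scalemxAl.
by rewrite -(odd_double_half (e i)) oi uo scaler0.
Qed.

(** The span of the odd powers as an inductive predicate: properties stable under linear
    combinations pass to it by induction. *)
Inductive odd_span A : 'M[R]_n -> Prop :=
| odd_span_gen m : odd_span A (A ^+ m.*2.+1)
| odd_span_lin a c d : odd_span A c -> odd_span A d -> odd_span A (a *: c + d).

Lemma odd_span_sqr A c : odd_span A c -> odd_span A (A *m (A *m c)).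
Proof.
elim=> [m|a d d' _ IH _ IH'].
  by rewrite mulmxE -!exprS -doubleS; exact: odd_span_gen.
by rewrite !mulmxDr -!scalemxAr; exact: odd_span_lin.
Qed.

Lemma odd_span0 A : odd_span A 0.
Proof.
have -> : 0 = -1 *: A ^+ (0.*2.+1) + A ^+ (0.*2.+1) by rewrite scaleN1r addNr.
by apply: odd_span_lin; exact: odd_span_gen.
Qed.

Lemma pid_mxS r : (pid_mx r.+1 : 'M[R]_n) =
  pid_mx r + (delta_mx r 0 : 'cV[R]_n) *m (delta_mx r 0)^T.
Proof.
rewrite trmx_delta mul_delta_mx; apply/matrixP => i j; rewrite !mxE ltnS.
rewrite -!val_eqE /=.
case: (ltngtP i r) => [ir|ir|->]; rewrite /= ?andbF ?addr0 ?andbT //.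
by rewrite add0r eq_sym.
Qed.

Lemma tr_last_col r x : so_mx x ->
  (last_col r x)^T = - ((delta_mx r 0 : 'cV[R]_n)^T *m x *m pid_mx r).
Proof.
move=> sx; rewrite !last_colE !colE !trmx_mul tr_pid_mx sx.
by rewrite mulmxN mulNmx.
Qed.

(** Expand both projections by [pid_mxS]: the corner grows by a border whose diagonal entry vanishes
    because [x] is skew. *)
Lemma corner_step r x : so_mx x -> corner r.+1 x =
  corner r x + last_col r x *m (delta_mx r 0)^T - delta_mx r 0 *m (last_col r x)^T.
Proof.
move=> sx; rewrite tr_last_col // !last_colE !colE !cornerE pid_mxS.
rewrite !mulmxDl !mulmxDr -[_ *m x *m (_ *m _)]mulmxA !mulmxA.
set e := delta_mx r 0.
have -> : e *m e^T *m x *m e *m e^T = 0.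
  have -> : e *m e^T *m x *m e *m e^T = e *m (e^T *m x *m e) *m e^T.
    by rewrite !mulmxA.
  by rewrite quad_skew // mulmx0 mul0mx.
by rewrite addr0 mulmxN opprK -!mulmxA.
Qed.

Lemma pid_delta r : (pid_mx r : 'M[R]_n) *m (delta_mx r 0 : 'cV_n) = 0.
Proof.
apply/colP => i; rewrite !mxE big1 // => j _; rewrite !mxE.
have [->|] := eqVneq j r; last by rewrite mulr0.
by rewrite val_eqE; have [->|_] := eqVneq i r; rewrite ?ltnn mul0r.
Qed.

Lemma delta_pid r : (delta_mx r 0 : 'cV[R]_n)^T *m (pid_mx r : 'M[R]_n) = 0.
Proof. by rewrite -[pid_mx r]tr_pid_mx -trmx_mul pid_delta trmx0. Qed.

Lemma corner_succ_delta r x : so_mx x ->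
  corner r.+1 x *m delta_mx r 0 = last_col r x.
Proof.
move=> sx; rewrite corner_step // mulmxBl mulmxDl {1}cornerE.
rewrite -[_ *m pid_mx r *m _]mulmxA pid_delta mulmx0.
rewrite add0r -!mulmxA tr_last_col // mulNmx -[_ *m pid_mx r *m _]mulmxA pid_delta.
rewrite !mulmx0 oppr0 mulmx0 subr0 trmx_delta mul_delta_mx.
by rewrite -[RHS]mulmx1; congr (_ *m _); apply/matrixP => i j; rewrite !ord1 !mxE.
Qed.

Lemma corner_succ_mul r x y : so_mx x -> pid_mx r *m y = y ->
  corner r.+1 x *m y = corner r x *m y - delta_mx r 0 *m ((last_col r x)^T *m y).
Proof.
move=> sx py; rewrite corner_step // mulmxBl mulmxDl -!mulmxA.
by rewrite -{2}py [(delta_mx r 0)^T *m _]mulmxA delta_pid mul0mx mulmx0 addr0.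
Qed.

(** Let [X], [Y] be the corners of sizes [r.+1], [r], let [v] be the last column and [e] the unit
    vector of index [r]. If [c e = u = Y^(2m) v], then [X^2 c e = Y^2 u - <v, Y u> e - <v, u> v],
    where [<v, Y u> = 0] since [Y^(2m+1)] is skew. As [X e = v], adding [<v, u> X] to [X^2 c]
    removes the last term. *)
Lemma even_krylov_col r x m : so_mx x -> exists2 c, odd_span (corner r.+1 x) c &
  c *m (delta_mx r 0 : 'cV[R]_n) = corner r x ^+ m.*2 *m last_col r x.
Proof.
move=> sx; elim: m => [|m [c oc ce]].
  exists (corner r.+1 x ^+ (0.*2.+1)); first exact: odd_span_gen.
  by rewrite expr0 mul1mx expr1 corner_succ_delta.
set X := corner r.+1 x in oc *; set Y := corner r x in ce *.
set v := last_col r x in ce *; set u := _ *m v in ce.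
have pu : pid_mx r *m u = u by apply/pid_cornerX/pid_last_col.
have pYu : pid_mx r *m (Y *m u) = Y *m u by rewrite mulmxA pid_corner.
have -> : Y ^+ m.+1.*2 *m v = Y *m (Y *m u).
  by rewrite /u doubleS !exprS -!mulmxE -!mulmxA.
pose t := (v^T *m u) 0 0.
exists (t *: X ^+ (0.*2.+1) + X *m (X *m c)).
  by apply: odd_span_lin; [exact: odd_span_gen | exact: odd_span_sqr].
rewrite mulmxDl -scalemxAl expr1 corner_succ_delta // -!mulmxA ce.
rewrite (corner_succ_mul sx pu) mulmxBr (corner_succ_mul sx pYu).
rewrite [X *m (_ *m (_ *m u))]mulmxA corner_succ_delta // -/v.
have -> : v^T *m (Y *m u) = 0.
  rewrite /u [Y *m _]mulmxA mulmxE -exprS mulmxA.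
  by apply/quad_skew/so_mxX/corner_so.
have -> : v *m (v^T *m u) = t *: v.
  by rewrite [v^T *m u]mx11_scalar -/t mul_mx_scalar.
by rewrite mulmx0 subr0 addrC subrK.
Qed.

Lemma trace11 (M : 'M[R]_1) : \tr M = 0 -> M = 0.
Proof. by rewrite trace_mx11 => E; rewrite [M]mx11_scalar E raddf0. Qed.

(** In [tr(x (a M - M a))], with [M] the odd power, replace [x] by its corner of size [r.+1] and
    split off the border by [corner_step]. The part [corner r x] commutes with [M] and cancels; as
    [M] kills the unit vector of index [r], the border leaves twice the scalar in question. *)
Lemma commutant_last_col r x a m : so_mx x -> so_mx a -> corner r.+1 a = a ->
  pairing (lie x a) (corner r x ^+ m.*2.+1) = 0 ->
  (last_col r x)^T *m corner r x ^+ m.*2.+1 *m (a *m (delta_mx r 0 : 'cV[R]_n)) = 0.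
Proof.
move=> sx sa ca; set M := corner r x ^+ _; set v := last_col r x.
set e : 'cV_n := delta_mx r 0.
have cM : corner r M = M by exact: cornerX.
have cM' : corner r.+1 M = M.
  by rewrite -[in LHS]cM -[RHS]cM !cornerE !mulmxA pid_mx_mulr // -!mulmxA pid_mx_mul.
have sM : so_mx M by exact/so_mxX/corner_so.
have cYM : corner r x *m M = M *m corner r x := commX _ _.
have [pM Mp] := corner_fix cM; clearbody M.
have Me : M *m e = 0 by rewrite -Mp -mulmxA pid_delta mulmx0.
have eM : e^T *m M = 0 by rewrite -pM mulmxA delta_pid mul0mx.
rewrite pairing_ad // pairing_skew // /lie mulmxBr linearB /= !mulmxA.
rewrite (mxtrace_corner _ ca cM') (mxtrace_corner _ cM' ca) corner_step // -/v -/e.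
rewrite !mulmxDl !mulNmx !mxtraceD ![\tr (- _)]raddfN /=.
have -> : \tr (corner r x *m a *m M) = \tr (corner r x *m M *m a).
  by rewrite cYM -[in RHS]mulmxA [RHS]mxtrace_mulC.
have -> : \tr (e *m v^T *m a *m M) = 0.
  by rewrite -!mulmxA mxtrace_mulC !mulmxA -[_ *m M *m e]mulmxA Me mulmx0 linear0.
have -> : \tr (v *m e^T *m M *m a) = 0.
  by rewrite -[v *m _ *m M]mulmxA eM mulmx0 mul0mx linear0.
have -> : \tr (v *m e^T *m a *m M) = \tr (e *m v^T *m M *m a).
  rewrite -[LHS]mxtrace_tr !trmx_mul trmxK sM sa !mulNmx mulmxN opprK.
  by rewrite mulmxA mxtrace_mulC !mulmxA.
move=> /eqP; rewrite mulf_eq0 invr_eq0 pnatr_eq0 orbF => /eqP E.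
apply: trace11; rewrite mxtrace_mulC !mulmxA; lra.
Qed.

Lemma odd_powers_coisotropic x (W : {vspace 'M[R]_n}) : so_mx x ->
  (forall r, \det (krylov r x) != 0) ->
  (forall s m, (s <= n)%N -> corner s x ^+ m.*2.+1 \in W) ->
  forall a, so_mx a ->
  (forall s m, (s <= n)%N -> pairing (lie x a) (corner s x ^+ m.*2.+1) = 0) ->
  a \in W.
Proof.
move=> sx dK hW a sa.
have ca : corner n a = a by rewrite cornerE pid_mx_1 mul1mx mulmx1.
suff H (p : nat) b : (p <= n)%N -> corner p b = b -> so_mx b ->
    (forall s m, (s <= n)%N -> pairing (lie x b) (corner s x ^+ m.*2.+1) = 0) ->
    b \in W by exact: H (leqnn n) ca sa.
elim: p b {a sa ca} => [|r IH] a rn ca sa ha.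
  by rewrite -ca !cornerE pid_mx_0 !mul0mx mem0v.
pose q := Ordinal rn; pose e : 'cV[R]_n := delta_mx q 0.
have [pa ap] := corner_fix ca.
(* [a *m e] is the last column of [a]; its entry of index [q] vanishes because [a] is skew, so
   [krylov_span] applies. *)
have ue : pid_mx q *m (a *m e) = a *m e.
  rewrite -{2}pa (pid_mxS q) -mulmxA mulmxDl -[_ *m e^T *m _]mulmxA.
  by rewrite [e^T *m _]mulmxA quad_skew // mulmx0 addr0.
have [w uE] := krylov_span (dK q) ue.
have sY : so_mx (corner q x) by exact: corner_so.
have := even_krylov_span sY uE (fun m =>
  commutant_last_col (r := q) sx sa ca (ha _ m (ltnW rn))).
(* Each even Krylov vector is the last column of a combination of odd powers of the larger corner;
   adding these up gives a [c] with the same last column as [a]. *)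
have : exists2 c, odd_span (corner r.+1 x) c & c *m e =
  \sum_(i < n | (i < q)%N && ~~ odd (q.-1 - i))
    w i *: (corner q x ^+ (q.-1 - i) *m last_col q x).
  elim/big_rec : _ => [|i y /andP[_ ei] [c oc ce]].
    by exists 0; [exact: odd_span0 | rewrite mul0mx].
  have [d od de] := even_krylov_col q (q.-1 - i)./2 sx.
  exists (w i *: d + c); first exact: odd_span_lin.
  rewrite mulmxDl -scalemxAl ce de; congr (_ *: (_ ^+ _ *m _) + _).
  by rewrite even_halfK.
case=> c oc <- ae.
(* By involution [c] satisfies the same orthogonality relations as [a], so these pass to [a - c]. *)
have [sc cc hc Wc] : [/\ so_mx c, corner r.+1 c = c,
    forall s m, pairing (lie x c) (corner s x ^+ m.*2.+1) = 0 & c \in W].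
  elim: oc => [m|t d d' _ [sd cd hd Wd] _ [sd' cd' hd' Wd']]; split.
  - exact/so_mxX/corner_so.
  - exact: cornerX.
  - by move=> s p; exact: corner_powers_commute.
  - exact: hW.
  - exact: so_mxP.
  - by rewrite !cornerE mulmxDr mulmxDl -scalemxAr -scalemxAl -!cornerE cd cd'.
  - by move=> s m; rewrite lieDr lieZr pairingPl hd hd' mulr0 addr0.
  - by rewrite memvD // memvZ.
have [pc cp] := corner_fix cc.
(* The last column of [a - c] is zero, and by skewness so is its last row: it lies in the corner of
   size [r]. *)
rewrite -[a](subrK c) memvD //; apply: IH.
- exact: ltnW.
- have be : (a - c) *m e = 0 by rewrite mulmxBl ae subrr.
  have sb : so_mx (a - c) by exact: so_mxB.
  have eb : e^T *m (a - c) = 0.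
    by rewrite -[a - c]trmxK -trmx_mul sb mulNmx be oppr0 trmx0.
  have pb : pid_mx r.+1 *m (a - c) = a - c by rewrite mulmxBr pa pc.
  have bp : (a - c) *m pid_mx r.+1 = a - c by rewrite mulmxBl ap cp.
  rewrite !cornerE -[in RHS]bp -[in RHS]pb (pid_mxS q) mulmxDl -/e.
  rewrite -[e *m _ *m _]mulmxA eb mulmx0 addr0 mulmxDr mulmxA -[_ *m (a - c) *m e]mulmxA.
  by rewrite be mulmx0 mul0mx addr0.
- exact: so_mxB.
- by move=> s m sn; rewrite lieDr lieNr pairingDl pairingNl ha // hc subrr.
Qed.

End Krylov.

(** * Polynomial functions and their derivatives *)

Section PolynomialObservables.
Variables (R : realType) (n : nat).

Notation amb := ('M[R]_n * 'M[R]_n)%type.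
Implicit Types (f g : amb -> R) (p v : amb) (A B : amb -> 'M[R]_n).

(** The integrals and the discriminant of the generic set are of this kind. Stability under
    directional derivatives gives smoothness; the restriction to lines gives density. *)
Inductive polyfun : (amb -> R) -> Prop :=
| polyfun_cst c : polyfun (fun=> c)
| polyfun_base i j : polyfun (fun p => p.1 i j)
| polyfun_fiber i j : polyfun (fun p => p.2 i j)
| polyfunD f g : polyfun f -> polyfun g -> polyfun (fun p => f p + g p)
| polyfunM f g : polyfun f -> polyfun g -> polyfun (fun p => f p * g p).

Lemma is_derive_base i j p v : differentiable (fun q : amb => q.1 i j) p /\
  'D_v (fun q : amb => q.1 i j) p = v.1 i j.
Proof.
have L : linear (fun q : amb => q.1 i j : R^o) by move=> a x y /=; rewrite !mxE.
pose h : {linear amb -> R^o} := HB.pack (fun q : amb => q.1 i j)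
  (GRing.isLinear.Build _ _ _ _ _ L).
have ch : continuous h.
  move=> q; apply: (@continuous_comp amb _ R fst (fun M : 'M[R]_n => M i j)).
    exact: cvg_fst.
  exact: coord_continuous.
have dh : differentiable h p by exact: linear_differentiable.
by split=> //; rewrite (deriveE _ dh) diff_lin.
Qed.

Lemma is_derive_fiber i j p v : differentiable (fun q : amb => q.2 i j) p /\
  'D_v (fun q : amb => q.2 i j) p = v.2 i j.
Proof.
have L : linear (fun q : amb => q.2 i j : R^o) by move=> a x y /=; rewrite !mxE.
pose h : {linear amb -> R^o} := HB.pack (fun q : amb => q.2 i j)
  (GRing.isLinear.Build _ _ _ _ _ L).
have ch : continuous h.
  move=> q; apply: (@continuous_comp amb _ R snd (fun M : 'M[R]_n => M i j)).
    exact: cvg_snd.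
  exact: coord_continuous.
have dh : differentiable h p by exact: linear_differentiable.
by split=> //; rewrite (deriveE _ dh) diff_lin.
Qed.

Lemma polyfun_differentiable f p : polyfun f -> differentiable f p.
Proof.
elim=> [c|i j|i j|g h _ dg _ dh|g h _ dg _ dh].
- exact: differentiable_cst.
- exact: (is_derive_base _ _ _ 0).1.
- exact: (is_derive_fiber _ _ _ 0).1.
- exact: differentiableD.
- exact: differentiableM.
Qed.

Lemma polyfun_derivable f p v : polyfun f -> derivable f p v.
Proof. by move=> pf; exact/diff_derivable/polyfun_differentiable. Qed.

Lemma polyfun_deriveD f g p v : polyfun f -> polyfun g ->
  'D_v (fun q => f q + g q) p = 'D_v f p + 'D_v g p.
Proof. by move=> pf pg; rewrite -deriveD //; exact: polyfun_derivable. Qed.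

Lemma polyfun_deriveM f g p v : polyfun f -> polyfun g ->
  'D_v (fun q => f q * g q) p = 'D_v f p * g p + f p * 'D_v g p.
Proof.
move=> pf pg; have := @deriveM _ _ f g p v (polyfun_derivable pf)
  (polyfun_derivable pg).
by rewrite addrC [g p *: _]mulrC.
Qed.

Lemma polyfun_derive f v : polyfun f -> polyfun (fun p => 'D_v f p).
Proof.
elim=> [c|i j|i j|g h pg dg ph dh|g h pg dg ph dh].
- under eq_fun do rewrite derive_cst; exact: polyfun_cst.
- under eq_fun do rewrite (is_derive_base _ _ _ _).2; exact: polyfun_cst.
- under eq_fun do rewrite (is_derive_fiber _ _ _ _).2; exact: polyfun_cst.
- by under eq_fun do rewrite polyfun_deriveD //; exact: polyfunD.
- under eq_fun do rewrite polyfun_deriveM //.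
  by apply: polyfunD; exact: polyfunM.
Qed.

Lemma smooth_polyfun f : polyfun f -> smooth f.
Proof.
move=> pf k; elim: k f pf => [|k IH] f pf /=.
  by move=> p; exact/differentiable_continuous/polyfun_differentiable.
split=> [p|v]; first exact: polyfun_differentiable.
exact/IH/polyfun_derive.
Qed.

Lemma eq_polyfun f g : f =1 g -> polyfun f -> polyfun g.
Proof. by move=> /funext ->. Qed.

Lemma polyfun_sum (I : Type) (r : seq I) (P : pred I) (F : I -> amb -> R) :
  (forall i, P i -> polyfun (F i)) -> polyfun (fun p => \sum_(i <- r | P i) F i p).
Proof.
move=> hF; elim: r => [|i r IH].
  by apply: eq_polyfun (polyfun_cst 0) => p; rewrite big_nil.
case Pi: (P i); last by apply: eq_polyfun IH => p; rewrite big_cons Pi.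
apply: eq_polyfun (polyfunD (hF i Pi) IH) => p; by rewrite big_cons Pi.
Qed.

Lemma polyfun_prod (I : Type) (r : seq I) (P : pred I) (F : I -> amb -> R) :
  (forall i, P i -> polyfun (F i)) -> polyfun (fun p => \prod_(i <- r | P i) F i p).
Proof.
move=> hF; elim: r => [|i r IH].
  by apply: eq_polyfun (polyfun_cst 1) => p; rewrite big_nil.
case Pi: (P i); last by apply: eq_polyfun IH => p; rewrite big_cons Pi.
apply: eq_polyfun (polyfunM (hF i Pi) IH) => p; by rewrite big_cons Pi.
Qed.

Lemma polyfun_derive_sum (I : Type) (r : seq I) (P : pred I) (F : I -> amb -> R) p v :
  (forall i, P i -> polyfun (F i)) ->
  'D_v (fun q => \sum_(i <- r | P i) F i q) p = \sum_(i <- r | P i) 'D_v (F i) p.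
Proof.
move=> hF; elim: r => [|i r IH].
  have -> : (fun q => \sum_(i <- [::] | P i) F i q) = (fun=> 0).
    by apply/funext => q; rewrite big_nil.
  by rewrite derive_cst big_nil.
have -> : (fun q => \sum_(j <- i :: r | P j) F j q) =
    (fun q => (if P i then F i q else 0) + \sum_(j <- r | P j) F j q).
  by apply/funext => q; rewrite big_cons; case: ifP => //; rewrite add0r.
rewrite big_cons; case: ifP => Pi; last first.
  by under eq_fun do rewrite add0r; rewrite IH.
by rewrite polyfun_deriveD ?IH //; [exact: hF | exact: polyfun_sum].
Qed.

Definition polymx (m1 m2 : nat) (A : amb -> 'M[R]_(m1, m2)) :=
  forall i j, polyfun (fun p => A p i j).

Definition dmx v A p : 'M[R]_n := \matrix_(i, j) 'D_v (fun q => A q i j) p.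

Lemma polymx_cst m1 m2 (M : 'M[R]_(m1, m2)) : polymx (fun=> M).
Proof. by move=> i j; exact: polyfun_cst. Qed.

Lemma polymx_base : polymx (fun p : amb => p.1).
Proof. by move=> i j; exact: polyfun_base. Qed.

Lemma polymx_fiber : polymx (fun p : amb => p.2).
Proof. by move=> i j; exact: polyfun_fiber. Qed.

Lemma polymx_tr A : polymx A -> polymx (fun p => (A p)^T).
Proof. by move=> pA i j; under eq_fun do rewrite mxE; exact: pA. Qed.

Lemma polymxM m1 m2 m3 (A : amb -> 'M[R]_(m1, m2)) (B : amb -> 'M[R]_(m2, m3)) :
  polymx A -> polymx B -> polymx (fun p => A p *m B p).
Proof.
move=> pA pB i j; under eq_fun do rewrite mxE.
by apply: polyfun_sum => k _; apply: polyfunM.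
Qed.

Lemma polymxX A m : polymx A -> polymx (fun p => A p ^+ m).
Proof.
move=> pA; elim: m => [|m IH]; first exact: polymx_cst.
by under eq_fun do rewrite exprS -mulmxE; exact: polymxM.
Qed.

Lemma polyfun_tr A : polymx A -> polyfun (fun p => \tr (A p)).
Proof. by move=> pA; apply: polyfun_sum => i _. Qed.

Lemma polyfun_det A : polymx A -> polyfun (fun p => \det (A p)).
Proof.
move=> pA; apply: polyfun_sum => s _; apply: polyfunM; first exact: polyfun_cst.
by apply: polyfun_prod => i _.
Qed.

Lemma dmx_cst v M p : dmx v (fun=> M) p = 0.
Proof. by apply/matrixP => i j; rewrite !mxE derive_cst. Qed.

Lemma dmx_base v p : dmx v (fun q => q.1) p = v.1.
Proof. by apply/matrixP => i j; rewrite !mxE (is_derive_base _ _ _ _).2. Qed.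

Lemma dmx_fiber v p : dmx v (fun q => q.2) p = v.2.
Proof. by apply/matrixP => i j; rewrite !mxE (is_derive_fiber _ _ _ _).2. Qed.

Lemma dmx_tr v A p : dmx v (fun q => (A q)^T) p = (dmx v A p)^T.
Proof.
by apply/matrixP => i j; rewrite !mxE; under eq_fun do rewrite mxE.
Qed.

Lemma dmxM v A B p : polymx A -> polymx B ->
  dmx v (fun q => A q *m B q) p = dmx v A p *m B p + A p *m dmx v B p.
Proof.
move=> pA pB; apply/matrixP => i j; rewrite !mxE.
under eq_fun do rewrite mxE.
rewrite polyfun_derive_sum => [|k _]; last by apply: polyfunM.
rewrite -big_split /=; apply: eq_bigr => k _.
by rewrite polyfun_deriveM // !mxE.
Qed.

Lemma derive_tr v A p : polymx A -> 'D_v (fun q => \tr (A q)) p = \tr (dmx v A p).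
Proof.
move=> pA; rewrite /mxtrace polyfun_derive_sum => [|i _]; last exact: pA.
by apply: eq_bigr => i _; rewrite mxE.
Qed.

Lemma derive_trX v A m p : polymx A ->
  'D_v (fun q => \tr (A q ^+ m.+1)) p = m.+1%:R * \tr (A p ^+ m *m dmx v A p).
Proof.
move=> pA; rewrite derive_tr; last exact: polymxX.
(* The induction carries a factor [B] commuting with [A p], into which each step moves one more
   factor [A p]. *)
suff H k (B : 'M[R]_n) : GRing.comm B (A p) ->
    \tr (B *m dmx v (fun q => A q ^+ k.+1) p) =
    k.+1%:R * \tr (B *m A p ^+ k *m dmx v A p).
  by have := H m 1 (commr_sym (commr1 _)); rewrite !mulmxE !mul1r.
elim: k B => [|k IH] B cB; first by rewrite mul1r expr0 mulmx1.
have -> : dmx v (fun q => A q ^+ k.+2) p =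
    dmx v A p *m A p ^+ k.+1 + A p *m dmx v (fun q => A q ^+ k.+1) p.
  rewrite -(dmxM v p pA (polymxX k.+1 pA)).
  by congr (dmx v _ p); apply/funext => q; rewrite exprS.
rewrite mulmxDr linearD /= mulmxA mxtrace_mulC [B *m (A p *m _)]mulmxA IH; last first.
  by apply: commr_sym; apply: commrM => //; exact: commr_sym.
have -> : B *m A p *m A p ^+ k = B *m A p ^+ k.+1 by rewrite exprS -mulmxA.
rewrite mulmxA.
have -> : A p ^+ k.+1 *m B = B *m A p ^+ k.+1 by apply/esym; exact: commrX.
by rewrite -[k.+2]addn1 natrD; ring.
Qed.

End PolynomialObservables.

(** * The open dense set of generic points *)

Section GenericPoints.
Variables (R : realType) (n : nat).

Notation amb := ('M[R]_n * 'M[R]_n)%type.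
Implicit Types (f : amb -> R) (p v : amb) (r : 'I_n).

Lemma polyfun_line f p v : polyfun f ->
  exists q : {poly R}, forall t, f (p + t *: v) = q.[t].
Proof.
elim=> [c|i j|i j|g h _ [a aE] _ [b bE]|g h _ [a aE] _ [b bE]].
- by exists c%:P => t; rewrite hornerC.
- by exists ((v.1 i j) *: 'X + (p.1 i j)%:P) => t; rewrite !hornerE /= !mxE; ring.
- by exists ((v.2 i j) *: 'X + (p.2 i j)%:P) => t; rewrite !hornerE /= !mxE; ring.
- by exists (a + b) => t; rewrite hornerD aE bE.
- by exists (a * b) => t; rewrite hornerM aE bE.
Qed.

(** On the line through [p] and [p + v] the function is a nonzero polynomial in one variable, so its
    zeros cannot fill any interval. *)
Lemma polyfun_nonzero_near f p v (e : R) : polyfun f -> f (p + v) != 0 -> 0 < e ->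
  exists2 t, `|t| < e & f (p + t *: v) != 0.
Proof.
move=> pf fv e0; have [q qE] := polyfun_line p v pf.
have q0 : q != 0.
  by apply: contraNneq fv => q0; rewrite -[v]scale1r qE q0 horner0.
(* These are [size q] distinct points, one more than the degree of [q]; [i.+2] keeps them strictly
   below [e]. *)
pose ts := [seq e / i.+2%:R | i <- iota 0 (size q)].
have uts : uniq ts.
  rewrite map_inj_uniq ?iota_uniq // => i j /(mulfI (lt0r_neq0 e0)) /invr_inj /eqP.
  by rewrite eqr_nat => /eqP [].
have : ~~ all (root q) ts.
  apply/negP => rts; have := max_poly_roots q0 rts uts.
  by rewrite size_map size_iota ltnn.
case/allPn => t /mapP[i _ ->] nr; exists (e / i.+2%:R); last by rewrite qE.
rewrite gtr0_norm ?divr_gt0 // ltr_pdivrMr // ltr_pMr // ltr1n //.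
Qed.

Lemma pid_mulE m r (A : 'M[R]_(n, m)) i j :
  ((pid_mx r : 'M[R]_n) *m A) i j = (i < r)%N%:R * A i j.
Proof.
rewrite mxE (bigD1 i) //= big1 ?addr0 => [|k /negPf ki].
  by rewrite !mxE eqxx.
by rewrite !mxE val_eqE eq_sym ki mul0r.
Qed.

Lemma corner_entry s (A : 'M[R]_n) i j :
  corner s A i j = ((i < s) && (j < s))%N%:R * A i j.
Proof.
rewrite cornerE mxE (bigD1 j) //= big1 ?addr0 => [|k /negPf kj].
  rewrite !mxE eqxx /= (bigD1 i) //= big1 ?addr0 => [|k /negPf ki].
    by rewrite !mxE eqxx /= -mulnb natrM; ring.
  by rewrite !mxE val_eqE eq_sym ki mul0r.
by rewrite !mxE val_eqE kj mulr0.
Qed.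

(** An explicit point where all the Krylov families are bases; density is obtained by moving towards
    it. *)
Definition tridiag : 'M[R]_n :=
  \matrix_(i, j) ((i == j.+1 :> nat)%:R - (j == i.+1 :> nat)%:R).

Lemma tridiag_so : so_mx tridiag.
Proof. by apply/matrixP => i j; rewrite !mxE opprB. Qed.

Lemma tridiag_last_col r (i : 'I_n) :
  last_col r tridiag i 0 = - (i.+1 == r :> nat)%:R.
Proof.
rewrite last_colE pid_mulE !mxE.
rewrite [(r : nat) == _]eq_sym; case: ltnP => ir.
  have -> : (i == r.+1 :> nat) = false by lia.
  by rewrite mul1r sub0r.
have -> : (i.+1 == r :> nat) = false by lia.
by rewrite mul0r oppr0.
Qed.

(** Each application of the corner moves the topmost nonzero entry up by one place and changes its
    sign. The entries below it, with [r <= i + m], are left open, as triangularity does not involve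
    them. *)
Lemma tridiag_krylov r m (i : 'I_n) : (i + m < r)%N ->
  (corner r tridiag ^+ m *m last_col r tridiag) i 0 =
  (i + m == r.-1)%N%:R * (-1) ^+ m.+1.
Proof.
elim: m i => [|m IH] i.
  rewrite addn0 => ir; rewrite expr0 mul1mx tridiag_last_col expr1 mulrN1.
  by congr (- _%:R); congr nat_of_bool; lia.
rewrite addnS => imr; have i1 : (i.+1 < n)%N by have := ltn_ord r; lia.
rewrite exprS -mulmxE -mulmxA mxE (bigD1 (Ordinal i1)) //= big1 ?addr0.
  rewrite IH /=; last by lia.
  rewrite corner_entry !mxE /= eqxx; have -> : ((i < r) && (i.+1 < r))%N by lia.
  have -> : (i == i.+2 :> nat) = false by lia.
  by rewrite addSn [_ ^+ m.+2]exprS mul1r sub0r !mulN1r mulrN.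
move=> k /eqP ki; rewrite corner_entry [tridiag i k]mxE.
have [kr|] := boolP ((i < r) && (k < r))%N; last by rewrite !mul0r.
have -> : (k == i.+1 :> nat) = false by apply/eqP => E; apply: ki; exact/val_inj.
have [E|_] := eqVneq (i : nat) k.+1; last by rewrite subrr mulr0 mul0r.
rewrite IH; last by lia.
have -> : (k + m == r.-1)%N = false by lia.
by rewrite mul0r mulr0.
Qed.

Lemma tridiag_krylov_det r : \det (krylov r tridiag) != 0.
Proof.
have tr : is_trig_mx (krylov r tridiag).
  apply/is_trig_mxP => i j ij; rewrite mxE.
  case: ifP => jr; last by rewrite -val_eqE /= ltn_eqF.
  rewrite tridiag_krylov; last by lia.
  have -> : (i + (r.-1 - j) == r.-1)%N = false by lia.
  by rewrite mul0r.
rewrite det_trig //; apply/prodf_neq0 => i _; rewrite mxE eqxx.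
case: ifP => ir; last exact: oner_neq0.
rewrite tridiag_krylov; last by lia.
have -> : (i + (r.-1 - i) == r.-1)%N by lia.
by rewrite mul1r expf_eq0 oppr_eq0 oner_eq0 andbF.
Qed.

Lemma polymx_corner s : polymx (fun p : amb => corner s p.2).
Proof.
under eq_fun do rewrite cornerE.
apply: polymxM; last exact: polymx_cst.
by apply: polymxM; [exact: polymx_cst | exact: polymx_fiber].
Qed.

Lemma polymx_krylov r : polymx (fun p : amb => krylov r p.2).
Proof.
move=> i j; have [jr|jr] := boolP (j < r)%N; last first.
  apply: eq_polyfun (@polyfun_cst R n (i == j)%:R) => p.
  by rewrite mxE (negPf jr).
have : polymx (fun p : amb => corner r p.2 ^+ (r.-1 - j) *m
    (pid_mx r *m (p.2 *m (delta_mx r 0 : 'cV[R]_n)))).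
  apply: polymxM; first exact/polymxX/polymx_corner.
  apply: polymxM; first exact: polymx_cst.
  by apply: polymxM; [exact: polymx_fiber | exact: polymx_cst].
by move=> /(_ i 0); apply: eq_polyfun => p; rewrite [RHS]mxE jr last_colE colE.
Qed.

(** It is nonzero exactly when, for every [r], [last_col r] is cyclic for the corner of size [r]. *)
Definition krylov_disc p : R := \prod_(r < n) \det (krylov r p.2).

Lemma polyfun_krylov_disc : polyfun krylov_disc.
Proof. by apply: polyfun_prod => r _; exact/polyfun_det/polymx_krylov. Qed.

Lemma krylov_disc_open : open [set p | krylov_disc p != 0].
Proof.
have -> : [set p | krylov_disc p != 0] = krylov_disc @^-1` (~` [set 0]).
  by apply/seteqP; split=> p /= /eqP.
apply: open_comp; last exact/closed_openC/closed_eq.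
by move=> p _; exact/differentiable_continuous/polyfun_differentiable/polyfun_krylov_disc.
Qed.

(** Only the fibre component moves, along the line from [p.2] to [tridiag], so the point stays in
    [cotangent_SO]; the discriminant is nonzero at [tridiag], hence at points of the line
    arbitrarily close to [p]. *)
Lemma krylov_disc_dense : @cotangent_SO R n `<=`
  closure ([set p | krylov_disc p != 0] `&` @cotangent_SO R n).
Proof.
move=> p [SOp sop] B Bp.
pose v : amb := (0, tridiag - p.2).
have pvE t : p + t *: v = (p.1, p.2 + t *: (tridiag - p.2)).
  by rewrite /v; apply/pair_equal_spec; split; rewrite /= ?scaler0 ?addr0.
have v0 : krylov_disc (p + v) != 0.
  rewrite -[v]scale1r pvE scale1r addrC subrK.
  by apply/prodf_neq0 => r _; exact: tridiag_krylov_det.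
have cont : (p + t *: v) @[t --> (0 : R)] --> p.
  rewrite -[X in _ --> X]addr0 -(scale0r v).
  apply: cvgD; first exact: cvg_cst.
  exact: scalel_continuous.
have /cont /nbhs_ballP[e /= e0 eB] := Bp.
have [t te ft] := polyfun_nonzero_near polyfun_krylov_disc v0 e0.
exists (p + t *: v); split; last first.
  by apply: eB; rewrite /ball /= sub0r normrN.
split=> //; rewrite pvE; split=> //=.
by rewrite addrC; apply: so_mxP => //; apply: so_mxB => //; exact: tridiag_so.
Qed.

End GenericPoints.

(** * Spans of arbitrary sets and orthogonal complements *)

Section LinearAlgebra.
Variables (K : fieldType) (vT : vectType K).
Implicit Types (U V W S : {vspace vT}) (u v : vT).

(** [X] may be infinite: take a finite family in [X] whose span has the largest dimension; no
    further element of [X] can enlarge it. *)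
Lemma exists_span (X : set vT) : exists U : {vspace vT},
  (forall u, X u -> u \in U) /\
  forall W : {vspace vT}, (forall u, X u -> u \in W) -> (U <= W)%VS.
Proof.
pose P d := `[< exists2 t : seq vT, (forall u, u \in t -> X u) & \dim <<t>> = d >].
have P0 : exists d, P d by exists (\dim <<[::] : seq vT>>); apply/asboolP; exists [::].
have Pb d : P d -> (d <= \dim {:vT})%N.
  by move=> /asboolP[t _ <-]; exact/dimvS/subvf.
case: (ex_maxnP P0 Pb) => d /asboolP[t tX td] dmax.
exists <<t>>%VS; split=> [u Xu|W XW]; last first.
  by apply/span_subvP => u /tX; exact: XW.
have Pu : P (\dim <<u :: t>>).
  by apply/asboolP; exists (u :: t) => // w; rewrite in_cons => /orP[/eqP->|/tX].
have sub : (<<t>> <= <<u :: t>>)%VS by rewrite span_cons addvSr.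
have /eqP -> : <<t>>%VS == <<u :: t>>%VS by rewrite eqEdim sub td dmax.
by rewrite memv_span // mem_head.
Qed.

(** [W] is the kernel in [S] of the map of pairings with a basis of [U]. Nondegeneracy makes the
    columns of the Gram matrix [G] independent, so this map is onto and the rank formula gives the
    dimension. *)
Lemma exists_orthogonal (B : vT -> vT -> K) U S :
  (forall u, linear (B^~ u : vT -> K^o)) -> (forall v, linear (B v : vT -> K^o)) ->
  (forall u, u \in U -> (forall v, v \in S -> B v u = 0) -> u = 0) ->
  exists W : {vspace vT},
    (forall v, v \in W <-> v \in S /\ forall u, u \in U -> B v u = 0) /\
    (\dim U + \dim W = \dim S)%N.
Proof.
move=> Bl Br nd; set d := \dim U; pose b := vbasis U.
pose phi v : 'rV[K]_d := \row_i B v b`_i.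
have phiL : linear phi.
  by move=> a v w; apply/rowP => i; rewrite !mxE Bl.
pose Phi : {linear vT -> 'rV[K]_d} := HB.pack phi (GRing.isLinear.Build _ _ _ _ _ phiL).
have B0 v : B v 0 = 0.
  have := Br v (-1) 0 0; rewrite scaler0 addr0 scaleN1r => ->.
  by rewrite addNr.
have BU v u : phi v = 0 -> u \in U -> B v u = 0.
  move=> pv uU; rewrite (coord_vbasis uU).
  have E (r : seq 'I_(\dim U)) (c : 'I_(\dim U) -> K) :
      B v (\sum_(i <- r) c i *: b`_i) = 0.
    elim: r => [|i r IH]; first by rewrite big_nil.
    rewrite big_cons Br IH addr0; have /rowP/(_ i) := pv; rewrite !mxE => ->.
    by rewrite scaler0.
  exact: E.
exists (S :&: lker (linfun Phi))%VS; split=> [v|].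
  rewrite memv_cap memv_ker lfunE /=; split=> [/andP[vS /eqP pv]|[vS Bv]].
    by split=> // u; exact: BU.
  rewrite vS /=; apply/eqP/rowP => i; rewrite !mxE Bv //.
  by apply: vbasis_mem; apply: mem_nth; rewrite size_tuple.
rewrite addnC -[RHS](limg_ker_dim (linfun Phi)); congr (_ + _)%N.
pose e := vbasis S.
pose G : 'M[K]_(\dim S, d) := \matrix_(i, j) B e`_i b`_j.
have GT : row_free G^T.
  apply/inj_row_free => c cG.
  have Bc v : v \in S -> B v (\sum_(j < d) c 0 j *: b`_j) = 0.
    move=> vS; rewrite (coord_vbasis vS).
    have E1 (w : vT) (r : seq 'I_d) : B w (\sum_(j <- r) c 0 j *: b`_j) =
        \sum_(j <- r) c 0 j * B w b`_j.
      elim: r => [|j r IH]; first by rewrite !big_nil B0.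
      by rewrite !big_cons Br IH.
    have E2 (r : seq 'I_(\dim S)) (a : 'I_(\dim S) -> K) :
        B (\sum_(i <- r) a i *: e`_i) (\sum_(j < d) c 0 j *: b`_j) = 0.
      elim: r => [|i r IH].
        rewrite big_nil; set y := \sum_(j < d) _.
        by have := Bl y (-1) 0 0; rewrite scaler0 addr0 scaleN1r => ->; rewrite addNr.
      rewrite big_cons Bl IH addr0 E1.
      have -> : \sum_(j < d) c 0 j * B e`_i b`_j = (c *m G^T) 0 i.
        by rewrite mxE; apply: eq_bigr => j _; rewrite !mxE.
      by rewrite cG mxE scaler0.
    exact: E2.
  have /nd /(_ Bc) c0 : \sum_(j < d) c 0 j *: b`_j \in U.
    apply: memv_suml => j _; apply: memvZ.
    by apply: vbasis_mem; apply: mem_nth; rewrite size_tuple.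
  have /freeP fb := basis_free (vbasisP U).
  by apply/rowP => j; rewrite mxE; exact: fb c0 j.
have /row_fullP[C CG] : row_full G by rewrite /row_full -mxrank_tr.
suff -> : (linfun Phi @: S)%VS = fullv by rewrite dimvf /dim /= mul1n.
apply/eqP; rewrite eqEsubv subvf; apply/subvP => z _; apply/memv_imgP.
(* [C] is a left inverse of the Gram matrix, so [z *m C] gives the coordinates of a preimage of
   [z]. *)
exists (\sum_i (z *m C) 0 i *: e`_i).
  apply: memv_suml => i _; apply: memvZ.
  by apply: vbasis_mem; apply: mem_nth; rewrite size_tuple.
rewrite linear_sum -[LHS]mulmx1 -CG mulmxA mulmx_sum_row; apply: eq_bigr => i _.
rewrite linearZ; congr (_ *: _); rewrite [RHS](lfunE Phi) /=; apply/rowP => j.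
by rewrite !mxE.
Qed.

End LinearAlgebra.

(** * Subspaces of so(n) spanned by basis elements *)

Section CoordinateSubspaces.
Variables (R : realType) (n : nat).
Implicit Types (P : {set 'I_n * 'I_n}) (A x v : 'M[R]_n).

Notation E p := (so_basis R p.1 p.2).

(** Admits one of the opposite elements [so_basis i j] and [so_basis j i], and excludes the zero
    element [i = j]. *)
Definition upper P := forall p, p \in P -> (p.1 < p.2)%N.

Definition coord_map P (w : 'rV[R]_#|P|) : 'M[R]_n :=
  \sum_(i < #|P|) w 0 i *: E (enum_val i).

Lemma coord_map_linear P : linear (@coord_map P).
Proof.
move=> a v w; rewrite /coord_map scaler_sumr -big_split /=; apply: eq_bigr => i _.
by rewrite !mxE scalerDl scalerA.
Qed.

HB.instance Definition _ P :=
  GRing.isLinear.Build R 'rV[R]_#|P| 'M[R]_n _ (@coord_map P) (@coord_map_linear P).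

Definition coord_space P : {vspace 'M[R]_n} := limg (linfun (@coord_map P)).

Lemma basis_orthonormal P p q : upper P -> p \in P -> q \in P ->
  pairing (E p) (E q) = (p == q)%:R.
Proof.
move=> uP /uP p12 /uP q12; rewrite pairing_basis; last exact: so_basis_so.
rewrite !mxE; case: p q p12 q12 => [i j] [k l] /= ij kl.
have -> : (i == l) && (j == k) = false.
  by apply/negP => /andP[/eqP E1 /eqP E2]; move: kl; rewrite -E1 -E2; lia.
by rewrite subr0 xpair_eqE.
Qed.

Lemma coord_space_basis P p : p \in P -> E p \in coord_space P.
Proof.
move=> pP; apply/memv_imgP; exists (delta_mx 0 (enum_rank_in pP p)); first exact: memvf.
rewrite lfunE /= /coord_map (bigD1 (enum_rank_in pP p)) //= big1 => [|i /negPf ip].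
  by rewrite !mxE !eqxx /= scale1r addr0 enum_rankK_in.
by rewrite !mxE ip andbF scale0r.
Qed.

Lemma coord_spaceP P v : upper P -> v \in coord_space P ->
  v = \sum_(p in P) pairing v (E p) *: E p.
Proof.
move=> uP /memv_imgP[w _ ->]; rewrite lfunE /=.
rewrite big_enum_val {1}/coord_map; apply: eq_bigr => i _; congr (_ *: _).
rewrite /coord_map pairing_suml (bigD1 i) //= big1 => [|j /negPf ji].
  by rewrite pairingZl (basis_orthonormal uP) ?enum_valP // eqxx mulr1 addr0.
rewrite pairingZl (basis_orthonormal uP) ?enum_valP //.
by rewrite (inj_eq enum_val_inj) ji mulr0.
Qed.

Lemma coord_space_so P v : v \in coord_space P -> so_mx v.
Proof.
move=> /memv_imgP[w _ ->]; rewrite lfunE /= /coord_map.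
elim/big_rec : _ => [|i y _ sy]; first exact: so_mx0.
exact/so_mxP/sy/so_basis_so.
Qed.

Lemma coord_space_dim P : upper P -> \dim (coord_space P) = #|P|.
Proof.
move=> uP; rewrite /coord_space limg_dim_eq; first by rewrite dimvf /dim /= mul1n.
apply/eqP; rewrite -subv0; apply/subvP => w; rewrite memv_cap memvf memv_ker lfunE /=.
move=> /eqP w0; rewrite memv0; apply/eqP/rowP => i; rewrite mxE.
have : pairing (coord_map w) (E (enum_val i)) = 0 by rewrite w0 pairing0l.
rewrite /coord_map pairing_suml (bigD1 i) //= big1 => [|j /negPf ji].
  by rewrite pairingZl (basis_orthonormal uP) ?enum_valP // eqxx mulr1 addr0.
rewrite pairingZl (basis_orthonormal uP) ?enum_valP //.
by rewrite (inj_eq enum_val_inj) ji mulr0.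
Qed.

Definition upper_cols (T : pred nat) : {set 'I_n * 'I_n} :=
  [set p : 'I_n * 'I_n | (p.1 < p.2)%N && T p.2].

Lemma upper_upper_cols T : upper (upper_cols T).
Proof. by move=> p; rewrite inE => /andP[]. Qed.

Definition all_upper := upper_cols xpredT.

Lemma upper_all_upper : upper all_upper.
Proof. exact: upper_upper_cols. Qed.

Lemma skew_expansion A : so_mx A -> A = \sum_(p in all_upper) A p.1 p.2 *: E p.
Proof.
move=> sA; apply/eqP; rewrite -subr_eq0; set B := \sum_(p in _) _.
have sB : so_mx B.
  rewrite /B; elim/big_rec : _ => [|i y _ sy]; first exact: so_mx0.
  exact/so_mxP/sy/so_basis_so.
have sAB : so_mx (A - B) by exact: so_mxB.
have up (i j : 'I_n) : (i < j)%N -> (A - B) i j = 0.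
  move=> ij; have ijP : (i, j) \in all_upper by rewrite inE ij.
  rewrite -pairing_basis // pairingDr pairingNr pairing_basis // /B pairing_sumr.
  rewrite (bigD1 (i, j)) //= big1 => [|q /andP[qP /negPf qij]].
    rewrite pairingZr (basis_orthonormal upper_all_upper ijP ijP) eqxx mulr1.
    by rewrite addr0 subrr.
  rewrite pairingZr (basis_orthonormal upper_all_upper ijP qP) eq_sym qij mulr0 //.
apply/eqP/matrixP => i j; rewrite [RHS]mxE; case: (ltngtP i j) => ij.
- exact: up.
- by rewrite (so_mxE j i sAB) up ?oppr0.
- by have := so_mxE i j sAB; rewrite (val_inj ij); lra.
Qed.

Lemma mem_all_upper_space A : so_mx A <-> A \in coord_space all_upper.
Proof.
split; last exact: coord_space_so.
move=> /skew_expansion ->; apply: memv_suml => p pP; apply: memvZ.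
exact: coord_space_basis.
Qed.

Lemma card_upper_cols (T : pred nat) :
  #|upper_cols T| = (\sum_(j < n | T j) j)%N.
Proof.
rewrite -sum1_card.
transitivity (\sum_(i < n) \sum_(j < n | (i < j)%N && T j) 1)%N.
  by rewrite pair_big_dep; apply: eq_bigl => p; rewrite inE.
rewrite (exchange_big_dep (fun j : 'I_n => T j)) /=; last by move=> i j _ /andP[].
apply: eq_bigr => j Tj; transitivity (\sum_(i < j) 1)%N; last first.
  by rewrite sum1_card card_ord.
rewrite (big_ord_widen n (fun=> 1%N)); last exact/ltnW.
by apply: eq_bigl => i; rewrite Tj andbT.
Qed.

Lemma card_all_upper : #|all_upper| = (n * n.-1)./2.
Proof.
by rewrite card_upper_cols -bin2 -bin2_sum big_mkord.
Qed.

Lemma double_card_all_upper : (#|all_upper| + #|all_upper| = n * n.-1)%N.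
Proof.
rewrite card_all_upper addnn -[RHS]odd_double_half; case: n => [|m] //=.
by rewrite oddM /= andNb.
Qed.


End CoordinateSubspaces.

(** * Coisotropic spans and completeness at generic points *)

Section Completeness.
Variables (R : realType) (n : nat).

Notation amb := ('M[R]_n * 'M[R]_n)%type.
Implicit Types (p u v w : amb) (A : 'M[R]_n).

Lemma poisson_tensorE p u v : so_mx u.2 -> poisson_tensor p u v =
  pairing u.1 v.2 + pairing (lie p.2 v.2 - v.1) u.2.
Proof. by move=> su; rewrite /poisson_tensor canonical_form_sharp. Qed.

Definition inbase A : amb := (A, 0).
Definition infiber A : amb := (0, A).

Lemma inbase_linear : linear inbase.
Proof. by move=> a A B; apply/pair_equal_spec; rewrite /= scaler0 addr0. Qed.

Lemma infiber_linear : linear infiber.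
Proof. by move=> a A B; apply/pair_equal_spec; rewrite /= scaler0 addr0. Qed.

HB.instance Definition _ :=
  GRing.isLinear.Build R 'M[R]_n amb _ inbase inbase_linear.
HB.instance Definition _ :=
  GRing.isLinear.Build R 'M[R]_n amb _ infiber infiber_linear.

(** The cotangent space of T^*SO(n) at a point, in the left trivialization. *)
Definition skew_pairs : {vspace amb} :=
  (linfun inbase @: coord_space R (all_upper n) +
   linfun infiber @: coord_space R (all_upper n))%VS.

Lemma mem_skew_pairs p : p \in skew_pairs <-> so_mx p.1 /\ so_mx p.2.
Proof.
split=> [/memv_addP[u /memv_imgP[A /mem_all_upper_space sA ->]]|[sA sB]].
  move=> [v /memv_imgP[B /mem_all_upper_space sB ->]] ->.
  by rewrite !lfunE /= addr0 add0r.
have -> : p = linfun inbase p.1 + linfun infiber p.2.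
  rewrite [LHS]surjective_pairing !lfunE /=.
  by apply/pair_equal_spec; rewrite /= addr0 add0r.
by apply: memv_add; apply: memv_img; apply/mem_all_upper_space.
Qed.

Lemma dim_skew_pairs : \dim skew_pairs = (n * n.-1)%N.
Proof.
rewrite dimv_disjoint_sum; last first.
  apply/eqP; rewrite -subv0; apply/subvP => u; rewrite memv_cap memv0.
  case/andP => /memv_imgP[A _ ->] /memv_imgP[B _]; rewrite !lfunE /=.
  by case=> -> _.
have ker0 (f : 'Hom('M[R]_n, amb)) (V : {vspace 'M[R]_n}) :
    (forall A, f A = 0 -> A = 0) -> (V :&: lker f)%VS = 0%VS.
  move=> fI; apply/eqP; rewrite -subv0; apply/subvP => A.
  by rewrite memv_cap memv_ker memv0 => /andP[_ /eqP /fI ->].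
rewrite [X in (X + _)%N]limg_dim_eq; last by apply: ker0 => A; rewrite lfunE => -[].
rewrite [X in (_ + X)%N]limg_dim_eq; last by apply: ker0 => A; rewrite lfunE => -[].
by rewrite coord_space_dim ?double_card_all_upper //; exact: upper_all_upper.
Qed.

(* The covectors orthogonal to the differentials of the components of the left
   momentum map are the (0, a), to which [odd_powers_coisotropic] applies. *)
Lemma coisotropic_span p (U : {vspace amb}) v : so_mx p.2 -> krylov_disc p != 0 ->
  (forall a, so_mx a -> (lie p.2 a, a) \in U) ->
  (forall s m, (s <= n)%N -> (0, corner s p.2 ^+ m.*2.+1) \in U) ->
  so_mx v.1 -> so_mx v.2 ->
  (forall u, u \in U -> poisson_tensor p v u = 0) -> v \in U.
Proof.
move=> sp dK hN hC sv1 sv2 ort.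
have v1 : v.1 = 0.
  apply: pairing_eq0; have := ort _ (hN _ sv1).
  by rewrite poisson_tensorE //= subrr pairing0l addr0.
have -> : v = infiber v.2 by rewrite [LHS]surjective_pairing v1.
suff : v.2 \in (linfun infiber @^-1: U)%VS by rewrite -memv_preim lfunE.
apply: (odd_powers_coisotropic sp) => //.
- by move: dK => /prodf_neq0 dK r; exact: dK.
- by move=> s m sn; rewrite -memv_preim lfunE; exact: hC.
move=> s m sn; have := ort _ (hC s m sn).
rewrite poisson_tensorE //= v1 pairing0l add0r subr0.
have sX : so_mx (corner s p.2 ^+ m.*2.+1) by exact/so_mxX/corner_so.
by rewrite pairing_ad // lieC pairingNr -pairing_ad // => /eqP; rewrite oppr_eq0 => /eqP.
Qed.

Lemma complete_at_generic (F : set (amb -> R)) p : so_mx p.2 -> krylov_disc p != 0 ->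
  (forall f, F f -> so_mx (differential f p).1 /\ so_mx (differential f p).2) ->
  (forall a, so_mx a -> exists2 f, F f & differential f p = (lie p.2 a, a)) ->
  (forall s m, (s <= n)%N -> exists2 f, F f &
    exists2 c, c != 0 & differential f p = (0, c *: corner s p.2 ^+ m.*2.+1)) ->
  complete_at F p.
Proof.
move=> sp dK hS hN hC.
have [U [XU UX]] := exists_span [set differential f p | f in F].
have US : (U <= skew_pairs)%VS.
  by apply: UX => u [f Ff <-]; apply/mem_skew_pairs; exact: hS.
(* An explicit bilinear form on all pairs of matrices that agrees with the Poisson tensor at [p]
   once [v] is in [skew_pairs]. *)
pose B v u := pairing v.1 u.2 + pairing (lie p.2 u.2 - u.1) v.2.
have Bl u : linear (B^~ u : amb -> R^o).
  by move=> a v w; rewrite /B /= pairingPl pairingPr /GRing.scale /=; ring.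
have Br v : linear (B v : amb -> R^o).
  move=> a u w; rewrite /B /= pairingPr lieDr lieZr opprD addrACA -scalerBr.
  by rewrite pairingPl /GRing.scale /=; ring.
have nd u : u \in U -> (forall v, v \in skew_pairs -> B v u = 0) -> u = 0.
  move=> /(subvP US) /mem_skew_pairs[su1 su2] Bu.
  have u2 : u.2 = 0.
    apply: pairing_eq0; have := Bu (inbase u.2); rewrite /B /= pairing0r addr0.
    by apply; apply/mem_skew_pairs; split=> //; exact: so_mx0.
  have u1 : u.1 = 0.
    apply: pairing_eq0; have := Bu (infiber u.1).
    rewrite /B /= pairing0l add0r u2 lie0r sub0r pairingNl => /(_ _)/eqP.
    rewrite oppr_eq0 => H; apply/eqP/H.
    by apply/mem_skew_pairs; split=> //; exact: so_mx0.
  by rewrite [u]surjective_pairing u1 u2.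
(* [K] is the symplectic orthogonal of [U] in the cotangent space; by [coisotropic_span] it lies in
   [U], hence is the kernel. *)
have [K [KP dimK]] := exists_orthogonal Bl Br nd.
exists U, K; split=> //; last by rewrite dimK dim_skew_pairs.
have BE v u : v \in skew_pairs -> poisson_tensor p v u = B v u.
  by move=> /mem_skew_pairs[_ sv]; rewrite poisson_tensorE.
move=> v; split=> [/KP[vS Bv]|[vU vP]].
  split; last by move=> u uU; rewrite BE // Bv.
  have /mem_skew_pairs[sv1 sv2] := vS.
  apply: (coisotropic_span sp dK) => //.
  - by move=> a /hN[f Ff <-]; apply: XU; exists f.
  - move=> s m /(hC _ m)[f Ff [c c0 E]].
    have : differential f p \in U by apply: XU; exists f.
    rewrite E => /(memvZ c^-1).
    have -> : c^-1 *: ((0, c *: corner s p.2 ^+ m.*2.+1) : amb) =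
        (0, corner s p.2 ^+ m.*2.+1).
      by apply/pair_equal_spec; rewrite /= scaler0 scalerA mulVf // scale1r.
    by [].
  - by move=> u uU; rewrite BE // Bv.
have vS := subvP US _ vU.
by apply/KP; split=> // u uU; rewrite -BE // vP.
Qed.

End Completeness.

(** * Bracket generation and the dual norm *)

Section SubRiemannian.
Variables (R : realType) (n : nat).
Implicit Types (P : {set 'I_n * 'I_n}) (x v y : 'M[R]_n).

Notation E p := (so_basis R p.1 p.2).

Lemma pairing_scalar_product (V : {vspace 'M[R]_n}) :
  scalar_product_on V (@pairing R n).
Proof.
split=> [u v _ _|c u v w _ _ _|u _ u0]; first exact: pairingC.
  exact: pairingPl.
by rewrite lt_neqAle pairing_ge0 andbT eq_sym; apply: contra_neq u0 => /pairing_eq0.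
Qed.

Lemma lie_last_col (i j l : 'I_n) : (i < j)%N -> (j < l)%N ->
  lie (so_basis R i l) (so_basis R j l) = - so_basis R i j.
Proof.
move=> ij jl; have il := ltn_trans ij jl.
have [nij nil njl] : [/\ i != j, i != l & j != l].
  by rewrite -!val_eqE /= !ltn_eqF.
rewrite /lie /so_basis !mulmxBl !mulmxBr !mul_delta_mx_cond.
rewrite !eqxx ![l == _]eq_sym ![j == i]eq_sym (negPf nij) (negPf nil) (negPf njl).
by rewrite !mulr0n !mulr1n !subr0 !sub0r opprK opprB addrC.
Qed.

(** By [lie_last_col], brackets of two elements of the last column give, up to sign, all basis
    elements of the other columns. *)
Lemma last_column_generates (V : {vspace 'M[R]_n}) (l : 'I_n) : l.+1 = n ->
  (forall i : 'I_n, (i < l)%N -> so_basis R i l \in V) -> lie_generates_so V.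
Proof.
move=> ln hV W VW cW A /skew_expansion ->.
apply: memv_suml => p; rewrite inE andbT => p12; apply: memvZ.
have [p2l|p2l] := eqVneq p.2 l.
  by rewrite p2l; apply: (subvP VW); apply: hV; rewrite -p2l.
have jl : (p.2 < l)%N.
  by move: p2l (ltn_ord p.2); rewrite -val_eqE /=; lia.
rewrite -[so_basis _ _ _]opprK -(lie_last_col p12 jl) memvN.
by apply: cW; apply: (subvP VW); apply: hV => //; exact: ltn_trans jl.
Qed.

Lemma pairing_cauchy_schwarz y v : pairing y v ^+ 2 <= pairing y y * pairing v v.
Proof.
have [/pairing_eq0 ->|y0] := eqVneq (pairing y y) 0.
  by rewrite !pairing0l mul0r expr0n.
have yy : 0 < pairing y y by rewrite lt_neqAle eq_sym y0 pairing_ge0.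
(* The pairing of this vector with itself is [|y|^2 (|y|^2 |v|^2 - <y, v>^2)]. *)
have := pairing_ge0 (pairing y y *: v - pairing y v *: y).
rewrite !(pairingDl, pairingDr, pairingNl, pairingNr, pairingZl, pairingZr).
rewrite (pairingC v y) => H; rewrite -subr_ge0 -(pmulr_rge0 _ yy).
by apply: le_trans H _; rewrite le_eqVlt; apply/orP; left; apply/eqP; ring.
Qed.

Definition coord_proj P x : 'M[R]_n := \sum_(p in P) pairing x (E p) *: E p.

Lemma coord_proj_coord_space P x : coord_proj P x \in coord_space R P.
Proof. by apply: memv_suml => p pP; apply/memvZ/coord_space_basis. Qed.

Lemma pairing_coord_proj P x v : upper P -> v \in coord_space R P ->
  pairing x v = pairing (coord_proj P x) v.
Proof.
move=> uP vP; rewrite {1}(coord_spaceP uP vP) pairing_sumr /coord_proj pairing_suml.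
by apply: eq_bigr => p _; rewrite pairingZl pairingZr mulrC (pairingC v).
Qed.

Lemma pairing_coord_proj_sqr P x : upper P ->
  pairing (coord_proj P x) (coord_proj P x) = \sum_(p in P) pairing x (E p) ^+ 2.
Proof.
move=> uP; rewrite -pairing_coord_proj //; last exact: coord_proj_coord_space.
by rewrite pairing_sumr; apply: eq_bigr => p _; rewrite pairingZr.
Qed.

(** On the distribution [x] acts as its orthogonal projection [y]. Cauchy-Schwarz bounds the
    supremum by [|y|], attained at [y / |y|], or at 0 when [y = 0]. *)
Lemma sr_dual_normE P (S : sub_riemannian R n) x : upper P ->
  sr_space S = coord_space R P -> sr_metric S = @pairing R n ->
  sr_dual_norm S x = Num.sqrt (pairing (coord_proj P x) (coord_proj P x)).
Proof.
move=> uP VE mE; rewrite /sr_dual_norm VE mE; set y := coord_proj P x.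
have yP : y \in coord_space R P by exact: coord_proj_coord_space.
set X := [set _ | _ in _].
have ub : ubound X (Num.sqrt (pairing y y)).
  move=> _ [v [vP vv] <-]; rewrite (pairing_coord_proj x uP vP) -/y -sqrtr_sqr.
  apply: ler_wsqrtr; apply: le_trans (pairing_cauchy_schwarz y v) _.
  by rewrite ler_piMr // pairing_ge0.
have Xy : X (Num.sqrt (pairing y y)).
  have [y0|y0] := eqVneq (pairing y y) 0.
    exists 0; first by rewrite /= mem0v pairing0l.
    by rewrite y0 sqrtr0 pairing0r normr0.
  have yy : 0 < pairing y y by rewrite lt_neqAle eq_sym y0 pairing_ge0.
  have s0 : 0 < Num.sqrt (pairing y y) by rewrite sqrtr_gt0.
  have sE : pairing y y = Num.sqrt (pairing y y) ^+ 2 by rewrite sqr_sqrtr ?ltW.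
  exists ((Num.sqrt (pairing y y))^-1 *: y).
    split; first exact: memvZ.
    rewrite pairingZl pairingZr {3}sE expr2 mulKf ?mulVf // gt_eqF //.
  rewrite pairingZr (pairing_coord_proj x uP yP) -/y {2}sE expr2 mulKf ?gt_eqF //.
  by rewrite ger0_norm // ltW.
apply/eqP; rewrite eq_le; apply/andP; split.
  by apply: ge_sup => //; exists (Num.sqrt (pairing y y)).
by apply: ub_le_sup => //; exists (Num.sqrt (pairing y y)).
Qed.

End SubRiemannian.

(** * The momentum map, the corner traces and their brackets *)

Section FirstIntegrals.
Variables (R : realType) (n : nat).

Notation amb := ('M[R]_n * 'M[R]_n)%type.
Implicit Types (p : amb) (C : 'M[R]_n).

Notation E p := (so_basis R p.1 p.2).

(* The component along C of the momentum map of the left translations. *)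
Definition momentum C p : R := pairing (p.1 *m p.2 *m p.1^T) C.

(** The exponent is even because odd powers of skew matrices have trace zero; the gradient is then
    an odd power. *)
Definition corner_trace s m p : R := \tr (corner s p.2 ^+ m.*2.+2).

Lemma polymx_moment : polymx (fun p : amb => p.1 *m p.2 *m p.1^T).
Proof.
apply: polymxM; last exact/polymx_tr/polymx_base.
by apply: polymxM; [exact: polymx_base | exact: polymx_fiber].
Qed.

Lemma polymx_trmulC C (A : amb -> 'M[R]_n) : polymx A -> polymx (fun p => (A p)^T *m C).
Proof. by move=> pA; apply: polymxM; [exact: polymx_tr | exact: polymx_cst]. Qed.

Lemma polyfun_momentum C : polyfun (momentum C).
Proof.
rewrite /momentum /pairing; apply: polyfunM; last exact: polyfun_cst.
exact/polyfun_tr/polymx_trmulC/polymx_moment.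
Qed.

Lemma derive_pairing C (A : amb -> 'M[R]_n) p v : polymx A ->
  'D_v (fun q => pairing (A q) C) p = pairing (dmx v A p) C.
Proof.
move=> pA; rewrite /pairing polyfun_deriveM; last exact: polyfun_cst; last first.
  exact/polyfun_tr/polymx_trmulC.
rewrite derive_cst mulr0 addr0 derive_tr; last exact: polymx_trmulC.
rewrite dmxM; [|exact: polymx_tr|exact: polymx_cst].
by rewrite dmx_cst mulmx0 addr0 dmx_tr.
Qed.

Lemma derive_momentum C p v : 'D_v (momentum C) p =
  pairing (v.1 *m p.2 *m p.1^T + p.1 *m v.2 *m p.1^T + p.1 *m p.2 *m v.1^T) C.
Proof.
rewrite derive_pairing; last exact: polymx_moment.
rewrite dmxM; last exact/polymx_tr/polymx_base; last first.
  by apply: polymxM; [exact: polymx_base|exact: polymx_fiber].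
rewrite dmxM; [|exact: polymx_base|exact: polymx_fiber].
by rewrite dmx_tr dmx_base dmx_fiber mulmxDl.
Qed.

Lemma pairing_conj (g x C : 'M[R]_n) :
  pairing (g *m x *m g^T) C = pairing x (g^T *m C *m g).
Proof.
rewrite /pairing !trmx_mul trmxK -!mulmxA mxtrace_mulC -!mulmxA //.
Qed.

Lemma conj_so (g C : 'M[R]_n) : so_mx C -> so_mx (g^T *m C *m g).
Proof. by move=> sC; rewrite /so_mx /= !trmx_mul trmxK sC mulNmx mulmxN mulmxA. Qed.

(** Along [g B] the matrix [g x g^T] moves by [g [B, x] g^T], as [B] is skew; moving the conjugation
    onto [C] and using ad-invariance gives the base component. *)
Lemma differential_momentum C p : cotangent_SO p -> so_mx C ->
  differential (momentum C) p =
  (lie p.2 (p.1^T *m C *m p.1), p.1^T *m C *m p.1).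
Proof.
case: p => g x [[/= gg _] sx] sC; have sb := conj_so g sC.
rewrite /differential /=; congr (_, _).
  rewrite -[RHS]skew_matrixE; last exact: lie_so.
  apply/matrixP => i j; rewrite [LHS]mxE [RHS]mxE derive_momentum /=.
  move: (so_basis R i j) (so_basis_so R i j) => B sB.
  rewrite mulmx0 mul0mx addr0 trmx_mul sB.
  have -> : g *m B *m x *m g^T + g *m x *m (- B *m g^T) = g *m lie B x *m g^T.
    by rewrite /lie mulmxBr mulmxBl mulNmx mulmxN !mulmxA.
  by rewrite pairing_conj pairing_ad.
rewrite -[RHS]skew_matrixE //.
apply/matrixP => i j; rewrite [LHS]mxE [RHS]mxE derive_momentum /=.
by rewrite !mul0mx trmx0 mulmx0 add0r addr0 pairing_conj.
Qed.

Lemma polyfun_corner_trace s m : polyfun (corner_trace s m).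
Proof. exact/polyfun_tr/polymxX/polymx_corner. Qed.

Lemma dmx_corner s p v : dmx v (fun q => corner s q.2) p = corner s v.2.
Proof.
under [X in dmx v X]eq_fun do rewrite cornerE.
have h : polymx (fun q : amb => (pid_mx s : 'M[R]_n) *m q.2).
  by apply: polymxM; [exact: polymx_cst|exact: polymx_fiber].
rewrite dmxM //; last exact: polymx_cst.
rewrite dmxM; [|exact: polymx_cst|exact: polymx_fiber].
by rewrite !dmx_cst mul0mx add0r mulmx0 addr0 dmx_fiber cornerE.
Qed.

(** The factor [m.*2.+2] is the exponent; the factor -2 comes from [tr(M E_ij) = - 2 M_ij] for skew
    [M]. *)
Lemma differential_corner_trace s m p : so_mx p.2 ->
  differential (corner_trace s m) p =
  (0, (- (2 * m.*2.+2)%:R) *: corner s p.2 ^+ m.*2.+1).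
Proof.
move=> sx; rewrite /differential; congr (_, _); apply/matrixP => i j; rewrite mxE.
  rewrite derive_trX; last exact: polymx_corner.
  have c0 : corner s (0 : 'M[R]_n) = 0 by rewrite cornerE mulmx0 mul0mx.
  by rewrite dmx_corner /= c0 mulmx0 linear0 mulr0 mxE.
rewrite derive_trX; last exact: polymx_corner.
rewrite dmx_corner /=; set M := corner s p.2 ^+ _.
have sM : so_mx M by exact/so_mxX/corner_so.
have -> : \tr (M *m corner s (so_basis R i j)) = \tr (M *m so_basis R i j).
  have [ML MR] := corner_fix (cornerX s p.2 m.*2).
  by rewrite cornerE !mulmxA MR mxtrace_mulC mulmxA ML.
have := pairing_basis i j sM.
rewrite pairingC pairing_skew // => /(congr1 (fun z => 2 * z)).
rewrite mulrCA mulfV ?pnatr_eq0 // mulr1 => E; rewrite mxE.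
by rewrite -[\tr _]opprK E natrM; ring.
Qed.

Lemma momentum_bracket C D p : cotangent_SO p -> so_mx C -> so_mx D ->
  momentum (lie C D) p = poisson (momentum C) (momentum D) p.
Proof.
move=> cp sC sD; rewrite /poisson /hamiltonian_field -/(poisson_tensor _ _ _).
rewrite !differential_momentum // poisson_tensorE //=; last exact: conj_so.
rewrite subrr pairing0l addr0; set b := _ *m C *m _; set b' := _ *m D *m _.
have sb : so_mx b by exact: conj_so.
rewrite pairing_ad // /momentum pairing_conj; congr (pairing _ _).
have [[gg _] _] := cp; have gg' : p.1 *m p.1^T = 1%:M by [].
have bb (A B : 'M[R]_n) : p.1^T *m A *m p.1 *m (p.1^T *m B *m p.1) =
    p.1^T *m (A *m B) *m p.1.
  by rewrite !mulmxA -[_ *m p.1 *m p.1^T]mulmxA gg' mulmx1.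
by rewrite /lie !bb mulmxBr mulmxBl.
Qed.

(** The momentum map generates the left translations, which fix [x]; of [f], only the form of its
    differential at [p] enters. *)
Lemma poisson_momentum_fiber C f (h : 'M[R]_n) p : cotangent_SO p -> so_mx C ->
  so_mx h -> differential f p = (0, h) -> poisson (momentum C) f p = 0.
Proof.
move=> cp sC sh df; rewrite /poisson /hamiltonian_field -/(poisson_tensor _ _ _).
rewrite differential_momentum // df poisson_tensorE /=; last exact: conj_so.
have sb := conj_so p.1 sC.
by rewrite subr0 !pairing_ad // [lie h _]lieC pairingNr subrr.
Qed.

Lemma poisson_fiber f k (a h : 'M[R]_n) p : so_mx a -> differential f p = (0, a) ->
  differential k p = (0, h) -> poisson f k p = pairing (lie p.2 h) a.
Proof.
move=> sa df dk; rewrite /poisson /hamiltonian_field -/(poisson_tensor _ _ _).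
by rewrite df dk poisson_tensorE //= pairing0l add0r subr0.
Qed.


End FirstIntegrals.

(** Greedy choice: take the summand [m] when [m <= s]. Otherwise [s <= m.-1], within reach of the
    remaining summands since [m.-1] is one of them when [m] is positive. *)
Lemma subset_sum m s : (s <= \sum_(j < m) j)%N ->
  exists T : pred nat, (\sum_(j < m | T j) j)%N = s.
Proof.
elim: m s => [|m IH] s.
  by rewrite big_ord0 leqn0 => /eqP ->; exists xpred0; rewrite big_ord0.
rewrite big_ord_recr /= => sm.
have [ms|ltsm] := leqP m s.
  have [|T hT] := IH (s - m)%N; first by rewrite leq_subLR addnC.
  exists (fun j => (j == m) || T j); rewrite big_mkcond big_ord_recr /= eqxx /=.
  rewrite -[RHS](subnK ms) -hT [in RHS]big_mkcond /=; congr (_ + _)%N.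
  by apply: eq_bigr => i _; rewrite ltn_eqF.
have [|T hT] := IH s.
  case: m ltsm {IH sm} => // m sm.
  by rewrite big_ord_recr /=; apply: leq_trans (leq_addl _ _).
exists (fun j => (j != m) && T j); rewrite big_mkcond big_ord_recr /= eqxx /= addn0.
rewrite -hT [in RHS]big_mkcond /=.
by apply: eq_bigr => i _; rewrite neq_ltn ltn_ord.
Qed.

(** * The structures attached to the chain of corners, and their integrability *)

Section ChainStructure.
Variables (R : realType) (n : nat).

Notation amb := ('M[R]_n * 'M[R]_n)%type.
Notation E p := (so_basis R p.1 p.2).
Implicit Types (T : pred nat) (x : 'M[R]_n) (p : amb).

Lemma exists_chain_structure T (l : 'I_n) : l.+1 = n -> T l ->
  exists S : sub_riemannian R n, sr_space S = coord_space R (upper_cols n T) /\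
    sr_metric S = @pairing R n.
Proof.
move=> ln Tl.
have gen : lie_generates_so (coord_space R (upper_cols n T)).
  apply: (last_column_generates ln) => i il.
  by apply: (@coord_space_basis R n _ (i, l)); rewrite inE il.
by exists (SubRiemannian (@coord_space_so R n _) gen (pairing_scalar_product _)).
Qed.

Lemma skew_eq A B : so_mx A -> so_mx B ->
  (forall i j : 'I_n, (i < j)%N -> A i j = B i j) -> A = B :> 'M[R]_n.
Proof.
move=> sA sB AB; rewrite (skew_expansion sA) (skew_expansion sB).
by apply: eq_bigr => p; rewrite inE => /andP[p12 _]; rewrite AB.
Qed.

Lemma coord_proj_so (P : {set 'I_n * 'I_n}) x : so_mx (coord_proj P x).
Proof. exact/coord_space_so/coord_proj_coord_space. Qed.

(* So the gradient of the Hamiltonian is that of a combination of the quadratic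
   Casimirs of the chain so(1) < so(2) < ... < so(n). *)
Lemma coord_proj_chain T x : so_mx x -> coord_proj (upper_cols n T) x =
  \sum_(j < n | T j) (corner j.+1 x - corner j x).
Proof.
move=> sx; apply: skew_eq; first exact: coord_proj_so.
  elim/big_rec : _ => [|j y _ sy]; first exact: so_mx0.
  rewrite -[_ - _]scale1r; apply: so_mxP => //.
  by apply: so_mxB; exact: corner_so.
move=> i j ij; rewrite -pairing_basis; last exact: coord_proj_so.
rewrite pairing_sumr summxE.
have uA := @upper_all_upper n.
have ijA : (i, j) \in all_upper n by rewrite inE ij.
(* Both sides have entry [x i j] at [(i, j)] if [T j] holds, and 0 otherwise. *)
rewrite (eq_bigr (fun q => ((i, j) == q)%:R * x i j)); last first.
  move=> q; rewrite inE => /andP[q12 _].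
  have qA : q \in all_upper n by rewrite inE q12.
  rewrite pairingZr (basis_orthonormal R uA ijA qA).
  have [<-|_] := eqVneq (i, j) q; last by rewrite mulr0 mul0r.
  by rewrite mulr1 mul1r pairingC pairing_basis.
have -> : \sum_(k < n | T k) (corner k.+1 x - corner k x) i j =
    \sum_(k < n | T k) (k == j)%:R * x i j.
  apply: eq_bigr => k _; rewrite !mxE !corner_entry -mulrBl; congr (_ * _).
  have -> : ((i < k.+1) && (j < k.+1))%N = (j <= k)%N by lia.
  have -> : ((i < k) && (j < k))%N = (j < k)%N by lia.
  by rewrite -val_eqE /=; case: (ltngtP k j); rewrite ?subrr ?subr0.
have [Tj|nTj] := boolP (T j).
  rewrite (bigD1 (i, j)) ?inE ?ij //= eqxx big1 => [|q /andP[_ /negPf qij]]; last first.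
    by rewrite eq_sym qij mul0r.
  rewrite [RHS](bigD1 j) //= eqxx big1 // => k /andP[_ /negPf ->].
  by rewrite mul0r.
rewrite !big1 // => [k Tk|q]; last first.
  rewrite inE => /andP[_ Tq]; have [E|] := eqVneq (i, j) q; last by rewrite mul0r.
  by move: Tq; rewrite -E (negPf nTj).
have [E|] := eqVneq k j; last by rewrite mul0r.
by move: Tk; rewrite E (negPf nTj).
Qed.

(** Squaring removes the root of [sr_dual_normE]: the Hamiltonian is a polynomial, to which the
    calculus of [polyfun] applies. *)
Lemma sr_hamiltonianE P (S : sub_riemannian R n) : upper P ->
  sr_space S = coord_space R P -> sr_metric S = @pairing R n ->
  sr_hamiltonian S = fun p =>
    (\sum_(q in P) pairing p.2 (E q) * pairing p.2 (E q)) * 2^-1.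
Proof.
move=> uP VE mE; apply/funext => p; rewrite /sr_hamiltonian (sr_dual_normE _ uP VE mE).
by rewrite sqr_sqrtr ?pairing_ge0 // pairing_coord_proj_sqr.
Qed.

Lemma polyfun_pairing (C : 'M[R]_n) : polyfun (fun p : amb => pairing p.2 C).
Proof.
rewrite /pairing; apply: polyfunM; last exact: polyfun_cst.
exact/polyfun_tr/polymx_trmulC/polymx_fiber.
Qed.

Lemma differential_sr_hamiltonian P (S : sub_riemannian R n) p : upper P ->
  sr_space S = coord_space R P -> sr_metric S = @pairing R n ->
  differential (sr_hamiltonian S) p = (0, coord_proj P p.2).
Proof.
move=> uP VE mE; rewrite (sr_hamiltonianE uP VE mE).
have D v : 'D_v (fun p : amb =>
    (\sum_(q in P) pairing p.2 (E q) * pairing p.2 (E q)) * 2^-1) p =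
    pairing v.2 (coord_proj P p.2).
  rewrite polyfun_deriveM; [|by apply: polyfun_sum => q _; apply: polyfunM;
    exact: polyfun_pairing|exact: polyfun_cst].
  rewrite derive_cst mulr0 addr0 polyfun_derive_sum; last first.
    by move=> q _; apply: polyfunM; exact: polyfun_pairing.
  rewrite pairing_sumr mulr_suml; apply: eq_bigr => q _.
  rewrite polyfun_deriveM; try exact: polyfun_pairing.
  rewrite derive_pairing; last exact: polymx_fiber.
  by rewrite dmx_fiber pairingZr; field.
rewrite /differential; congr (_, _).
  by apply/matrixP => i j; rewrite mxE D pairing0l mxE.
rewrite -[RHS](skew_matrixE (coord_proj_so _ _)).
by apply/matrixP => i j; rewrite !mxE D.
Qed.

Lemma poissonC f h p : poisson f h p = - poisson h f p.
Proof.
rewrite /poisson /canonical_form lieC pairingNr; ring.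
Qed.

Definition chain_integrals : set (amb -> R) := [set f |
  (exists2 C, so_mx C & f = momentum C) \/ exists s m, f = corner_trace s m].

Lemma chain_integrals_smooth f : chain_integrals f -> smooth f.
Proof.
case=> [[C _ ->]|[s [m ->]]]; apply: smooth_polyfun.
  exact: polyfun_momentum.
exact: polyfun_corner_trace.
Qed.

Lemma so_mxZ c (A : 'M[R]_n) : so_mx A -> so_mx (c *: A).
Proof. by move=> sA; rewrite -[_ *: _]addr0; apply: so_mxP => //; exact: so_mx0. Qed.

Lemma poisson_corner_trace s m s' m' p : so_mx p.2 ->
  poisson (corner_trace s m) (corner_trace s' m') p = 0.
Proof.
move=> sx; have dc := differential_corner_trace _ _ sx.
rewrite (poisson_fiber _ (dc s m) (dc s' m')); last exact/so_mxZ/so_mxX/corner_so.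
by rewrite lieZr pairingZl pairingZr corner_powers_commute // !mulr0.
Qed.

Lemma poisson_momentum_corner_trace C s m p : cotangent_SO p -> so_mx C ->
  poisson (momentum C) (corner_trace s m) p = 0.
Proof.
move=> cp sC; have sx : so_mx p.2 by case: cp.
apply: (poisson_momentum_fiber cp sC _ (differential_corner_trace s m sx)).
exact/so_mxZ/so_mxX/corner_so.
Qed.

Lemma chain_integrals_closed : poisson_closed chain_integrals.
Proof.
(* [momentum 0] is the zero function and represents every vanishing bracket. *)
have F0 : chain_integrals (momentum 0) by left; exists 0 => //; exact: so_mx0.
have m0 p : momentum 0 p = 0 by rewrite /momentum pairing0r.
move=> f h [[C sC ->]|[s [m ->]]] [[D sD ->]|[s' [m' ->]]].
- exists (momentum (lie C D)); first by left; exists (lie C D) => //; exact: lie_so.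
  by move=> p cp; exact: momentum_bracket.
- by exists (momentum 0) => // p cp; rewrite m0 poisson_momentum_corner_trace.
- exists (momentum 0) => // p cp.
  by rewrite m0 poissonC poisson_momentum_corner_trace // oppr0.
- by exists (momentum 0) => // p [_ sx]; rewrite m0 poisson_corner_trace.
Qed.

Lemma chain_integrals_first_integral T (S : sub_riemannian R n) f :
  sr_space S = coord_space R (upper_cols n T) -> sr_metric S = @pairing R n ->
  chain_integrals f -> first_integral (sr_hamiltonian S) f.
Proof.
move=> VE mE Ff p cp; have [_ sx] := cp.
have dH := differential_sr_hamiltonian p (@upper_upper_cols n T) VE mE.
case: Ff => [[C sC ->]|[s [m ->]]].
  by apply: (poisson_momentum_fiber cp sC _ dH); exact: coord_proj_so.
rewrite (poisson_fiber _ (differential_corner_trace s m sx) dH); last first.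
  exact/so_mxZ/so_mxX/corner_so.
rewrite pairingZr (_ : pairing _ _ = 0) ?mulr0 // coord_proj_chain //.
elim/big_rec : _ => [|j y _ IH]; first by rewrite lie0r pairing0l.
rewrite lieDr pairingDl IH addr0 lieDr lieNr pairingDl pairingNl.
(* A corner is its own odd power of exponent [0.*2.+1], so involution applies to the terms of
   [coord_proj_chain]. *)
have c1 k := corner_powers_commute 0 m k s sx.
by rewrite -[corner j.+1 _]expr1 -[corner j _]expr1 !c1 subrr.
Qed.

Lemma chain_integrals_complete p : cotangent_SO p -> krylov_disc p != 0 ->
  complete_at chain_integrals p.
Proof.
move=> cp dK; have [[gg _] sx] := cp; have dc := differential_corner_trace _ _ sx.
apply: complete_at_generic => //.
- move=> f [[C sC ->]|[s [m ->]]].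
    by rewrite differential_momentum //=; split; [apply: lie_so => //|]; exact: conj_so.
  by rewrite dc /=; split; [exact: so_mx0 | exact/so_mxZ/so_mxX/corner_so].
- move=> a sa; exists (momentum (p.1 *m a *m p.1^T)).
    left; exists (p.1 *m a *m p.1^T) => //.
    by have := conj_so p.1^T sa; rewrite trmxK.
  rewrite differential_momentum //; last by have := conj_so p.1^T sa; rewrite trmxK.
  suff -> : p.1^T *m (p.1 *m a *m p.1^T) *m p.1 = a by [].
  have gg' : p.1^T *m p.1 = 1%:M by apply: mulmx1C.
  by rewrite !mulmxA gg' mul1mx -mulmxA gg' mulmx1.
- move=> s m _; exists (corner_trace s m); first by right; exists s, m.
  by exists (- (2 * m.*2.+2)%:R); rewrite ?dc // oppr_eq0 pnatr_eq0.
Qed.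

Lemma nc_integrable_chain T (S : sub_riemannian R n) :
  sr_space S = coord_space R (upper_cols n T) -> sr_metric S = @pairing R n ->
  nc_integrable (sr_hamiltonian S).
Proof.
move=> VE mE; exists chain_integrals; split.
- exact: chain_integrals_smooth.
- by move=> f; exact: chain_integrals_first_integral VE mE.
- exact: chain_integrals_closed.
exists [set p | krylov_disc p != 0]; split; first exact: krylov_disc_open.
  exact: krylov_disc_dense.
by move=> p dK cp; exact: chain_integrals_complete.
Qed.

End ChainStructure.

Theorem mainTheorem4 (R : realType) (n k : nat) (hn : (3 <= n)%N)
    (hk1 : (n.-1 <= k)%N) (hk2 : (k < (n * n.-1)./2)%N) :
  exists S : sub_riemannian R n,
    sr_rank S = k /\ nc_integrable (sr_hamiltonian S).
Proof.
case: n hn hk1 hk2 => // m hn hk1 hk2.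
(* Column [j] has [j] entries above the diagonal. The last column, of length [m], is always taken
   for generation, so the earlier ones must contribute [k - m]. *)
have [|T hT] := @subset_sum m (k - m).
  by move: hk2; rewrite -bin2 -bin2_sum big_mkord big_ord_recr /=; move: hk1 => /=; lia.
pose T' : pred nat := fun j => (j == m) || T j.
have Tm : T' (ord_max : 'I_m.+1) by rewrite /T' /= eqxx.
have [S [VE mE]] := exists_chain_structure R (erefl : (ord_max : 'I_m.+1).+1 = m.+1) Tm.
exists S; split; last exact: nc_integrable_chain VE mE.
rewrite /sr_rank VE coord_space_dim; last exact: upper_upper_cols.
rewrite card_upper_cols big_mkcond big_ord_recr /= /T' eqxx /=.
rewrite -[RHS](subnK hk1) -hT [in RHS]big_mkcond /=; congr (_ + _)%N.
by apply: eq_bigr => i _; rewrite ltn_eqF.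
Qed.
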